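(* Let $\mathcal{G}$ be an additive arithmetical semigroup satisfying Axiom $A^{\#}$ with constants $c_{\mathcal{G}}>0$, $q>1$, $0\le\eta<1$, and with $Z_{\mathcal{G}}(-q^{-1})\neq0$; equip it with the norm $\|g\|=q^{\partial(g)}$. Let $S\subseteq\mathcal{P}$ have natural density $\delta(S)$. Let $a\colon\mathcal{G}\to\mathbb{C}$ be supported on $\mathfrak{D}(\mathcal{G},S)$ with $a(e_{\mathcal{G}})=1$ and $$\lim_{n\to\infty}\sum_{\substack{1\le\partial(g)\le n\\ g\in\mathfrak{D}(\mathcal{G},S)}}\frac{|a(g)|}{\|g\|}\log\log\|g\|<\infty.$$ Then $$-\lim_{n\to\infty}\sum_{\substack{1\le\partial(g)\le n\\ g\in\mathfrak{D}(\mathcal{G},S)}}\frac{(\mu*a)(g)}{\|g\|}=\delta(S).$$ In particular, if $a$ is the identity of the convolution ring ($a(e_{\mathcal{G}})=1$, $a(g)=0$ otherwise), then $$-\lim_{n\to\infty}\sum_{\substack{1\le\partial(g)\le n\\ g\in\mathfrak{D}(\mathcal{G},S)}}\frac{\mu(g)}{\|g\|}=\delta(S).$$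
   Context: An additive arithmetical semigroup is a commutative monoid $\mathcal{G}$ (written additively, identity $e_{\mathcal{G}}$) freely generated by a countable set $\mathcal{P}$ of primes, with a degree map $\partial\colon\mathcal{G}\to\mathbb{Z}_{\ge0}$ satisfying $\partial(e_{\mathcal{G}})=0$, $\partial(P)>0$ for $P\in\mathcal{P}$, $\partial(g+h)=\partial(g)+\partial(h)$, and such that only finitely many elements have degree $\le x$ for each $x$. Let $G^{\#}(n)=\#\{g:\partial(g)=n\}$. Axiom $A^{\#}$: $G^{\#}(n)=c_{\mathcal{G}}q^n+O(q^{\eta n})$ with $c_{\mathcal{G}}>0$, $q>1$, $0\le\eta<1$. The zeta function is $Z_{\mathcal{G}}(z)=\prod_{P\in\mathcal{P}}(1-z^{\partial(P)})^{-1}$ (meromorphically continued), and it is assumed that $Z_{\mathcal{G}}(-q^{-1})\ne0$. Natural density: $\delta(S)=\lim_{n\to\infty}\#\{P\in S:\partial(P)=n\}/\#\{P\in\mathcal{P}:\partial(P)=n\}$. $h\mid g$ means $g=h+r$ for some $r\in\mathcal{G}$. For $g\ne e_{\mathcal{G}}$, $d_-(g)=\min\{\partial(P):P\in\mathcal{P},P\mid g\}$; $g$ is distinguishable if $g\ne e_{\mathcal{G}}$ and there is a unique prime $P_{\min}(g)\mid g$ with $\partial(P_{\min}(g))=d_-(g)$. $\mathfrak{D}(\mathcal{G},S)=\{g\text{ distinguishable}:P_{\min}(g)\in S\}\cup\{e_{\mathcal{G}}\}$. Möbius function: $\mu(e_{\mathcal{G}})=1$, $\mu(P_1+\dots+P_k)=(-1)^k$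 for distinct primes, $\mu(g)=0$ if $2P\mid g$ for some prime $P$. $a$ is supported on $\mathfrak{D}(\mathcal{G},S)$ if $a(g)=0$ for $g\notin\mathfrak{D}(\mathcal{G},S)$. $(\mu*a)(g)=\sum_{h\mid g}\mu(h)a(g-h)$, where $g-h$ denotes the $r$ with $h+r=g$. *)

(* Defs.v *)
From HB Require Import structures.
From mathcomp Require Import all_boot all_order all_algebra.
From mathcomp Require Import all_classical all_reals all_analysis.
From mathcomp Require Import complex.
From mathcomp.finmap Require Import finmap multiset.

Set Implicit Arguments.
Unset Strict Implicit.
Unset Printing Implicit Defensive.

Import Order.TTheory GRing.Theory Num.Theory numFieldTopology.Exports numFieldNormedType.Exports.
Local Open Scope mset_scope.
Local Open Scope classical_set_scope.
Local Open Scope ring_scope.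

(* Topology on R[i]: the standard metric topology induced by the norm of the
   numClosedFieldType R[i] (used only to speak of limits of complex sums). *)
HB.instance Definition _ (R : rcfType) := PseudoPointedMetric.copy R[i] (R[i])^o.

(* G is modelled as the free commutative monoid {mset P} on the set P of     *)
(* primes (identity mset0, operation msetD = `+`); a prime p is [mset p].     *)
(* The degree map is determined by its values deg : P -> nat on primes.      *)
Section Semigroup.
Variables (P : choiceType) (deg : P -> nat).

Definition degG (g : {mset P}) : nat := (\sum_(p <- g) deg p)%N.

Definition Gsharp (n : nat) : nat :=
  (\sum_(g \in [set g : {mset P} | degG g = n]) 1)%N.

Definition prime_count (S : set P) (n : nat) : nat :=
  (\sum_(p \in [set p : P | S p /\ deg p = n]) 1)%N.

Definition has_natural_density (R : realType) (S : set P) (delta : R) : Prop :=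
  (fun n => (prime_count S n)%:R / (prime_count setT n)%:R : R) @ \oo --> delta.

Definition mdvd (h g : {mset P}) : Prop := exists r : {mset P}, g = msetD h r.

Definition pdvd (p : P) (g : {mset P}) : Prop := mdvd [mset p] g.

Definition is_Pmin (g : {mset P}) (p : P) : Prop :=
  pdvd p g /\ forall p' : P, pdvd p' g -> (deg p <= deg p')%N.

Definition distinguishable (g : {mset P}) : Prop :=
  g <> mset0 /\ exists! p : P, is_Pmin g p.

Definition Dset (S : set P) : set {mset P} :=
  [set g | g = mset0 \/ (distinguishable g /\ exists p, is_Pmin g p /\ S p)].

Definition squarefree (g : {mset P}) : bool := all (fun p => (g p <= 1)%N) (finsupp g).

Definition mobius (R : pzRingType) (g : {mset P}) : R :=
  if squarefree g then (-1) ^+ size (g : seq P) else 0.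

(* Dirichlet convolution (mu * a)(g) = sum_{h | g} mu(h) a(g - h);
   g - h is the multiset difference msetB g h, the unique r with h + r = g. *)
Definition mu_conv (R : pzRingType) (a : {mset P} -> R) (g : {mset P}) : R :=
  \sum_(h \in [set h | mdvd h g]) mobius R h * a (msetB g h).

Definition normG (R : realType) (q : R) (g : {mset P}) : R := q ^+ degG g.

Definition Dn (S : set P) (n : nat) : set {mset P} :=
  [set g | (1 <= degG g <= n)%N /\ Dset S g].

(* Value at z = -1/q of the meromorphic continuation of
   Z_G(z) = prod_P (1 - z^deg P)^-1 = sum_n G#(n) z^n,
   written out under Axiom A#:  Z_G(z) = c/(1 - q z) + sum_n (G#(n) - c q^n) z^n,
   the last series converging for |z| < q^-eta. *)
Definition Zeta_at_minus_inv_q (R : realType) (c q : R) : R :=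
  c / 2 + limn (fun N => \sum_(0 <= n < N) (((Gsharp n)%:R - c * q ^+ n) * (- q^-1) ^+ n)).

End Semigroup.

(* Main.v *)
Require Import Defs.
From HB Require Import structures.
From mathcomp Require Import all_boot all_order all_algebra.
From mathcomp Require Import all_classical all_reals all_analysis.
From mathcomp Require Import complex.
From mathcomp.finmap Require Import finmap multiset.
From mathcomp Require Import cyclic cyclotomic.
From mathcomp Require Import ring lra zify.
Import Order.TTheory GRing.Theory Num.Theory numFieldTopology.Exports numFieldNormedType.Exports.
Local Open Scope mset_scope.
Local Open Scope classical_set_scope.
Local Open Scope ring_scope.

(** Scale everything by [q^-n], so that [zeta_n = G#(n) q^-n = c + O(rho^n)] with [rho < 1], and write
    [*] for the Cauchy product, [Z(w)] for the generating series of [zeta] and [F(w) = (1 - w) Z(w)].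
    [F] does not vanish on [|w| <= 1]: inside the disc because the Moebius series inverts [Z], at [1]
    because [F(1) = c], at [-1] by hypothesis, elsewhere on the circle by the 3-4-1 argument.  Hence
    [1/F] has absolutely summable coefficients [e_n = sum_{deg g <= n} mu(g) / ||g||].

    A distinguishable squarefree [g] is [P + h] with all primes of [h] of degree [> deg P], so the main
    sum is [- sum_m s_m V_m(n - m)], where [s_m] is the scaled number of primes of degree [m] in [S] and
    [V_m] is the summatory function of [mu(h) / ||h||] over such [h].  Since [V_m = e * psi_m] with
    [psi_m] counting the elements all of whose primes have degree [<= m], this equals [- (e * t)_n] with
    [t_k = sum_m s_m psi_m(k - m)], the scaled number of pairs ([g] of degree [k], prime of maximal
    degree of [g] lying in [S]).  As the maximal prime is almost always unique, [t_k - delta zeta_k -> 0]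
    and [(e * t)_n -> delta].

    For general [a], the terms with [a(r)], [r <> e], carry a factor that tends to [0] for each [r] and
    is [O(log deg r)] uniformly, by [|V_m| <= C] and Chebyshev's bound [O(1/m)] on the scaled prime
    counts; dominated convergence concludes. *)

Set Implicit Arguments.
Unset Strict Implicit.
Unset Printing Implicit Defensive.

(** * Cauchy products and absolutely summable sequences *)

(** Passing from [Z] to [F] removes the pole at 1: the coefficients of [F] are [O(rho^n)], so [F]
    and its derivative converge absolutely on the whole closed disc, and continuity, compactness and
    Bessel's inequality can be read off coefficients. The 3-4-1 argument at [u] involves [Z] near
    [u^2], which is the pole itself when [u = -1]; hence the separate hypothesis at that point.
    Absolute summability of [e] is what turns [t_k - delta zeta_k -> 0] into a limit: the Cauchy
    product with a summable sequence preserves null sequences, while [e * zeta] is constantly 1;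
    boundedness of [e] alone would not do. Control of the primes comes from the logarithmic
    derivative of [Z], whose coefficients turn out to be bounded; the density then compares [S] with
    all primes degree by degree. The double logarithm in the assumption on [a] equals
    [log deg r + log log q]. It matches the harmonic sum of scaled prime counts up to the smallest
    prime degree of [r], which is the cost of replacing [e] by [r]. *)

Section CauchyProduct.
Variable K : comNzRingType.
Implicit Types a b c l : nat -> K.

Definition conv a b : nat -> K := fun n => \sum_(i < n.+1) a i * b (n - i)%N.
Definition delta0 : nat -> K := fun n => (n == 0)%:R.
Definition ones : nat -> K := fun _ => 1.
(** The polynomial [1 - w X]: the boolean multiplicity kills every coefficient from degree 2 on. *)
Definition oneminus (w : K) : nat -> K :=
  fun n => if n is n'.+1 then - (w *+ (n' == 0)) else 1.
(** The Euler operator [X d/dX] rather than [d/dX]: it is still a derivation for [conv] and shifts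
    no index. *)
Definition der a : nat -> K := fun n => n%:R * a n.
(** Substitution [X -> w X]: the value of the series [a] at [w] is the sum of [twist w a], and the
    scaling by [q^-n] is [twist q^-1]. *)
Definition twist (w : K) a : nat -> K := fun n => a n * w ^+ n.

(** Reduces the ring laws of [conv] to those of polynomials. The truncation order [m] is free above
    [n], so that all the indices met in [convA] share the same polynomials. *)
Lemma conv_coef a b m n : (n <= m)%N ->
  conv a b n = ((\poly_(i < m.+1) a i) * (\poly_(i < m.+1) b i))`_n.
Proof.
move=> nm; rewrite coefM; apply: eq_bigr => i _; rewrite !coef_poly.
have im : (i < m.+1)%N by apply: leq_trans (ltn_ord i) _.
by rewrite im ltnS (leq_trans (leq_subr _ _)).
Qed.

Lemma convC a b : conv a b = conv b a.
Proof. by apply/funext => n; rewrite !(conv_coef _ _ (leqnn n)) mulrC. Qed.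

Lemma convA a b c : conv a (conv b c) = conv (conv a b) c.
Proof.
apply/funext => n.
transitivity ((\poly_(i < n.+1) a i * (\poly_(i < n.+1) b i * \poly_(i < n.+1) c i))`_n).
  rewrite coefM; apply: eq_bigr => i _; rewrite coef_poly (ltn_ord i).
  by rewrite -conv_coef // leq_subr.
rewrite mulrA coefM; apply: eq_bigr => i _.
by rewrite -conv_coef -1?ltnS // coef_poly ltnS leq_subr.
Qed.

Lemma eq_conv a a' b b' n :
  (forall i, (i <= n)%N -> a i = a' i) -> (forall i, (i <= n)%N -> b i = b' i) ->
  conv a b n = conv a' b' n.
Proof.
move=> ea eb; apply: eq_bigr => i _.
by rewrite ea -1?ltnS // eb // leq_subr.
Qed.

Lemma conv0d a : conv delta0 a = a.
Proof.
apply/funext => n; rewrite /conv big_ord_recl /= mul1r subn0 big1 ?addr0 // => i _.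
by rewrite /delta0 mul0r.
Qed.

Lemma conv_ones a n : conv a ones n = \sum_(i < n.+1) a i.
Proof. by apply: eq_bigr => i _; rewrite mulr1. Qed.

Lemma conv_oneminusS w a n : conv (oneminus w) a n.+1 = a n.+1 - w * a n.
Proof.
rewrite /conv big_ord_recl /= mul1r subn0 big_ord_recl /= subSS subn0 mulr1n.
by rewrite big1 ?addr0 ?mulNr // => i _; rewrite mulr0n oppr0 mul0r.
Qed.

Lemma conv_oneminus0 w a : conv (oneminus w) a 0 = a 0.
Proof. by rewrite /conv big_ord1 /= mul1r. Qed.

Lemma conv_oneminus_ones : conv (oneminus 1) ones = delta0.
Proof.
apply/funext => -[|n]; first by rewrite conv_oneminus0.
by rewrite conv_oneminusS mulr1 subrr.
Qed.

Lemma convDl a b c : conv (fun n => a n + b n) c = (fun n => conv a c n + conv b c n).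
Proof.
by apply/funext => n; rewrite -big_split; apply: eq_bigr => i _; rewrite mulrDl.
Qed.

Lemma convZl x a b : conv (fun n => x * a n) b = (fun n => x * conv a b n).
Proof.
by apply/funext => n; rewrite mulr_sumr; apply: eq_bigr => i _; rewrite mulrA.
Qed.

Lemma der_conv a b : der (conv a b) = (fun n => conv (der a) b n + conv a (der b) n).
Proof.
apply/funext => n; rewrite /der /conv mulr_sumr -big_split; apply: eq_bigr => i _ /=.
have -> : n%:R = i%:R + (n - i)%:R :> K by rewrite -natrD subnKC // -ltnS.
by rewrite mulrDl mulrA; congr (_ + _); rewrite mulrCA.
Qed.

Lemma twist_conv w a b : conv (twist w a) (twist w b) = twist w (conv a b).
Proof.
apply/funext => n; rewrite /twist /conv mulr_suml; apply: eq_bigr => i _ /=.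
have -> : w ^+ n = w ^+ i * w ^+ (n - i) by rewrite -exprD subnKC // -ltnS.
by rewrite mulrACA.
Qed.

Lemma twist_delta0 w : twist w delta0 = delta0.
Proof. by apply/funext => -[|n]; rewrite /twist /delta0 /= ?mulr1 ?mul0r. Qed.

Lemma twist_oneminus w : twist w (oneminus 1) = oneminus w.
Proof.
apply/funext => -[|[|n]]; rewrite /twist /oneminus /= ?mulr1 //.
  by rewrite mulN1r.
by rewrite oppr0 mul0r.
Qed.

Lemma twistM v w a : twist v (twist w a) = twist (w * v) a.
Proof. by apply/funext => n; rewrite /twist exprMn mulrA. Qed.

(** [l] is the logarithmic derivative [X a' / a], written without division so that it makes sense
    for formal series. *)
Definition logder a l := der a = conv l a.

Lemma logder_conv a b l l' : logder a l -> logder b l' ->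
  logder (conv a b) (fun n => l n + l' n).
Proof.
rewrite /logder => ha hb; rewrite der_conv ha hb convDl; apply/funext => n.
by congr (_ + _); rewrite convA // (convC a) convA.
Qed.

Lemma logder_twist w a l : logder a l -> logder (twist w a) (twist w l).
Proof.
rewrite /logder twist_conv => <-; apply/funext => n.
by rewrite /der /twist mulrA.
Qed.

Definition convn a k := iter k (conv a) delta0.

Lemma logder_convn a l k : logder a l -> logder (convn a k) (fun n => k%:R * l n).
Proof.
move=> h; elim: k => [|k ih] /=.
  apply/funext => n; rewrite /der /delta0 /conv big1 ?(mul0r, mulr0) //.
    by case: n => [|n]; rewrite ?mul0r ?mulr0.
  by move=> i _; rewrite !mul0r.
rewrite /logder (logder_conv h ih); congr (conv _ _); apply/funext => n.
by rewrite mulrS mulrDl mul1r.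
Qed.

End CauchyProduct.

(** The relation reads [n a_n = sum_i l_i a_(n-i)]. As [l_0 = 0], the right-hand side involves only
    earlier coefficients, and strong induction applies. *)
Lemma logder_ge0 (K : numFieldType) (a l : nat -> K) :
  logder a l -> 0 <= a 0 -> l 0 = 0 -> (forall n, 0 <= l n) -> forall n, 0 <= a n.
Proof.
move=> h a0 l0 lge; elim/ltn_ind => -[//|n] ih.
have := congr1 (fun f => f n.+1) h; rewrite /der /conv big_ord_recl l0 mul0r add0r => e.
rewrite -(pmulr_rge0 _ (ltr0Sn K n)) e sumr_ge0 // => i _.
by rewrite mulr_ge0 // ih // /lift /= /bump /=; lia.
Qed.

(** Serves both the norm of [R] and the modulus [normc] of [R[i]], whose values lie in [R], whereas
    the canonical norm of [R[i]] takes values in [R[i]] itself. *)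
Record absolute_value (R : realType) (K : comNzRingType) (N : K -> R) : Prop :=
  AbsoluteValue {
    abs0 : N 0 = 0;
    abs1 : N 1 = 1;
    abs_ge0 : forall x, 0 <= N x;
    absM : forall x y, N (x * y) = N x * N y;
    absD : forall x y, N (x + y) <= N x + N y;
    absN : forall x, N (- x) = N x }.

(** * Limits and absolutely summable series for a real-valued absolute value *)

Section Norms.
Variables (R : realType) (K : comNzRingType) (N : K -> R).
Hypothesis HN : absolute_value N.
Let N0 := abs0 HN.
Let N1 := abs1 HN.
Let N_ge0 := abs_ge0 HN.
Let NM := absM HN.
Let ND := absD HN.
Let NN := absN HN.
Implicit Types a b c : nat -> K.

Definition tends a (s : K) :=
  forall e : R, 0 < e -> exists n0, forall n, (n0 <= n)%N -> N (a n - s) <= e.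

Definition l1bd a (A : R) := forall n, \sum_(i < n) N (a i) <= A.

Definition has_sum a s := tends (fun n => \sum_(i < n) a i) s.

Lemma N_sum (I : Type) (r : seq I) (P : pred I) (F : I -> K) :
  N (\sum_(i <- r | P i) F i) <= \sum_(i <- r | P i) N (F i).
Proof.
elim/big_rec2: _ => [|i y x _ h]; first by rewrite N0.
by apply: le_trans (ND _ _) _; rewrite lerD2l.
Qed.

Lemma tendsN0 a s : tends a s -> tends (fun n => a n - s) 0.
Proof. by move=> h e /h [n0 hn]; exists n0 => n /hn; rewrite subr0. Qed.

Lemma tendsD a b s t : tends a s -> tends b t -> tends (fun n => a n + b n) (s + t).
Proof.
move=> ha hb e e0; have e2 : 0 < e / 2 by lra.
have [n1 h1] := ha _ e2; have [n2 h2] := hb _ e2.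
exists (maxn n1 n2) => n; rewrite geq_max => /andP[/h1 k1 /h2 k2].
by rewrite opprD addrACA; apply: le_trans (ND _ _) _; lra.
Qed.

Lemma tendsZ x a s : tends a s -> tends (fun n => x * a n) (x * s).
Proof.
move=> h e e0; have x0 := N_ge0 x.
have [|n0 hn] := h (e / (N x + 1)); first by rewrite divr_gt0 //; lra.
exists n0 => n /hn; rewrite -mulrBr NM => k.
apply: le_trans (_ : (N x + 1) * N (a n - s) <= _).
  by rewrite ler_wpM2r //; lra.
by rewrite mulrC -ler_pdivlMr //; lra.
Qed.

Lemma tends_uniq a s t : tends a s -> tends a t -> N (s - t) = 0.
Proof.
move=> hs ht; apply/eqP; rewrite eq_le N_ge0 andbT; apply/ler_addgt0Pr => e e0.
have e2 : 0 < e / 2 by lra.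
have [n1 h1] := hs _ e2; have [n2 h2] := ht _ e2.
have := h1 (maxn n1 n2); have := h2 (maxn n1 n2); rewrite leq_maxl leq_maxr => /(_ isT) k1 /(_ isT) k2.
have -> : s - t = - (a (maxn n1 n2) - s) + (a (maxn n1 n2) - t) by ring.
by apply: le_trans (ND _ _) _; rewrite NN; lra.
Qed.

Lemma eq_tends a b s : a =1 b -> tends a s -> tends b s.
Proof. by move=> e; have -> : a = b by apply/funext. Qed.

Lemma tends_cst s : tends (fun=> s) s.
Proof. by move=> e e0; exists 0%N => n _; rewrite subrr N0 ltW. Qed.

Lemma tends_shiftS a s : tends (fun n => a n.+1) s -> tends a s.
Proof. by move=> h e /h [n0 hn]; exists n0.+1 => -[//|n] /hn. Qed.

Lemma tends_bd a s : tends a s -> exists2 X, 0 < X & forall n, N (a n) <= X.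
Proof.
move=> h; have [n0 hn] := h 1 ltr01.
exists (\sum_(i < n0) N (a i) + N s + 1) => [|n].
  by rewrite ltr_wpDl ?ltr01 // addr_ge0 ?sumr_ge0.
have S0 : 0 <= \sum_(i < n0) N (a i) by rewrite sumr_ge0.
case: (leqP n0 n) => [/hn|] k.
  have -> : a n = (a n - s) + s by ring.
  by apply: le_trans (ND _ _) _; lra.
rewrite (bigD1 (Ordinal k)) //= -addrA; have : 0 <= \sum_(i < n0 | i != Ordinal k) N (a i) by rewrite sumr_ge0.
by have := N_ge0 s; lra.
Qed.

Lemma tends_le a s A : tends a s -> (forall n, N (a n) <= A) -> N s <= A.
Proof.
move=> h b; apply/ler_addgt0Pr => e e0; have [n0 hn] := h _ e0.
have := hn _ (leqnn _) => k; have -> : s = - (a n0 - s) + a n0 by ring.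
by apply: le_trans (ND _ _) _; rewrite NN addrC lerD.
Qed.

Lemma l1_tail a A : l1bd a A -> forall e, 0 < e ->
  exists n0, forall n, \sum_(n0 <= i < n) N (a i) <= e.
Proof.
move=> h e e0; pose u n := \sum_(i < n) N (a i).
have um : {homo u : m n / (m <= n)%N >-> m <= n}.
  move=> m n mn; rewrite /u -!(big_mkord xpredT (fun i => N (a i))).
  by rewrite [leRHS](big_cat_nat (n:=m)) //= lerDl sumr_ge0.
have ub : has_ubound (range u) by exists A => _ [n _ <-]; exact: h.
have u0 : range u !=set0 by exists (u 0%N), 0%N.
have [_ [n0 _ <-] hn] := sup_adherent e0 (conj u0 ub).
exists n0 => n; case: (leqP n0 n) => k; last by rewrite big_geq ?ltW // ltnW.
have : u n <= sup (range u) by apply: sup_upper_bound => //; exists n.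
have -> : u n = u n0 + \sum_(n0 <= i < n) N (a i).
  by rewrite /u -!(big_mkord xpredT (fun i => N (a i))) (big_cat_nat (n:=n0)).
by move: hn; rewrite -/u; lra.
Qed.

(** Exchange the sums over the triangle [i <= k < n]: for fixed [i], the sum over [k] is a partial
    sum of the norms of [b], shifted by [i]. *)
Lemma l1_conv a b A B : l1bd a A -> l1bd b B -> l1bd (conv a b) (A * B).
Proof.
move=> ha hb n.
apply: le_trans (_ : \sum_(k < n) \sum_(i < n) (if (i <= k)%N then N (a i) * N (b (k - i)%N) else 0) <= _).
  apply: ler_sum => k _; apply: le_trans (N_sum _ _ _) _.
  rewrite -big_mkcond /= (big_ord_widen n (fun i => N (a i * b (k - i)%N)) (ltn_ord k)) /=.
  by under eq_bigl => i do rewrite ltnS; apply: ler_sum => i _; rewrite NM.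
rewrite exchange_big /=; apply: le_trans (_ : \sum_(i < n) N (a i) * B <= _); last first.
  by rewrite -mulr_suml ler_wpM2r // (le_trans _ (hb 0%N)) // big_ord0.
apply: ler_sum => i _; rewrite -big_mkcond /= -mulr_sumr ler_wpM2l //.
apply: le_trans (hb n).
rewrite -(big_mkord (fun k => i <= k)%N (fun k => N (b (k - i)%N))).
rewrite (big_cat_nat (n:=i)) ?(ltnW (ltn_ord i)) //=.
rewrite big_nat_cond big1 ?add0r; last by move=> k /andP[/andP[_ ki]]; rewrite leqNgt ki.
rewrite -{1}[nat_of_ord i]add0n big_addn -(big_mkord xpredT (fun k => N (b k))).
rewrite [leRHS](big_cat_nat (n:=(n - i)%N)) ?leq_subr //= .
rewrite -[leLHS]addr0 lerD ?sumr_ge0 // [leLHS]big_mkcond ler_sum // => k _.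
by case: ifP => _; rewrite ?addnK.
Qed.

(** Split [sum_i a_i x_(n-i)] at [i = n2]. Below it, [n - i] is large and [x] is small; above it,
    [x] is bounded by [X] and the tail of [a] is small. *)
Lemma conv_tends0 a x A : l1bd a A -> tends x 0 -> tends (conv a x) 0.
Proof.
move=> ha hx e e0; have [X X0 hX] := tends_bd hx.
have A0 : 0 <= A by rewrite (le_trans _ (ha 0%N)) // big_ord0.
have [|n1 h1] := hx (e / (2 * (A + 1))); first by rewrite divr_gt0 //; lra.
have [|n2 h2] := l1_tail ha (e := e / (2 * X)); first by rewrite divr_gt0 //; lra.
exists (n1 + n2)%N => n hn; rewrite subr0; apply: le_trans (N_sum _ _ _) _.
rewrite -(big_mkord xpredT (fun i => N (a i * x (n - i)%N))) (big_cat_nat (n:=n2)) //=; last by lia.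
(* The middle summand is slack: the denominator is [A + 1] because [A] may be 0. *)
have -> : e = A * (e / (2 * (A + 1))) + (e / (2 * (A + 1))) + (e / (2 * X)) * X.
  by field; apply/andP; split; lra.
apply: lerD.
  apply: le_trans (_ : A * (e / (2 * (A + 1))) <= _); last first.
    by rewrite lerDl divr_ge0 //; lra.
  apply: le_trans (ler_wpM2r _ (ha n2)); last by rewrite divr_ge0 //; lra.
  rewrite mulr_suml -(big_mkord xpredT (fun i => N (a i) * _)).
  rewrite !big_nat; apply: ler_sum => i /andP[_ i2]; rewrite NM ler_wpM2l //.
  by rewrite -[x _]subr0 h1 //; lia.
apply: le_trans (ler_wpM2r (ltW X0) (h2 n.+1)).
by rewrite mulr_suml; apply: ler_sum => i _; rewrite NM ler_wpM2l.
Qed.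

(** [a * x] is the null sequence [a * (x - t)] plus [t] times the partial sums of [a]. *)
Lemma conv_tends a x A s t : l1bd a A -> has_sum a s -> tends x t -> tends (conv a x) (s * t).
Proof.
move=> ha hs hx.
have k1 : tends (conv a (fun n => x n - t)) 0 by apply: conv_tends0 ha (tendsN0 hx).
have k2 : tends (fun n => t * \sum_(i < n.+1) a i) (t * s).
  by apply: tendsZ => e /hs [n0 hn]; exists n0 => n k; apply: hn; lia.
rewrite mulrC -[t * s]add0r; apply: eq_tends (tendsD k1 k2) => n.
rewrite /conv mulr_sumr -big_split; apply: eq_bigr => i _ /=; ring.
Qed.

(** Mertens' theorem. Partial sums are convolutions with [ones], so by associativity those of
    [a * b] are [a] convolved with the partial sums of [b]. *)
Lemma has_sum_conv a b A s t : l1bd a A -> has_sum a s -> has_sum b t ->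
  has_sum (conv a b) (s * t).
Proof.
move=> ha hs ht; apply: tends_shiftS.
have h : tends (fun n => \sum_(i < n.+1) b i) t.
  by move=> e /ht [n0 hn]; exists n0 => n k; apply: hn; lia.
have := conv_tends ha hs h; apply: eq_tends => n.
rewrite -conv_ones -convA; congr (conv _ _ n); apply/funext => k.
by rewrite conv_ones.
Qed.

Lemma has_sum_le a A s : l1bd a A -> has_sum a s -> N s <= A.
Proof. by move=> ha /tends_le; apply => n; apply: le_trans (N_sum _ _ _) (ha n). Qed.

Lemma has_sum_tail a s e n : has_sum a s ->
  (forall m, \sum_(n <= i < m) N (a i) <= e) -> N (\sum_(i < n) a i - s) <= e.
Proof.
move=> hs ht; apply/ler_addgt0Pr => d /hs [n0 hn].
have := hn (maxn n n0); rewrite leq_maxr => /(_ isT).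
rewrite -!(big_mkord xpredT (fun i => a i)) (big_cat_nat (n:=n)) ?leq_maxl //= => k.
set S := \sum_(0 <= i < n) a i in k *; set T := \sum_(n <= i < _) a i in k.
have -> : S - s = - T + (S + T - s) by ring.
apply: le_trans (ND _ _) _; rewrite NN lerD //; apply: le_trans (ht (maxn n n0)).
exact: N_sum.
Qed.

Lemma l1_delta0 : l1bd (delta0 K) 1.
Proof.
case=> [|n]; first by rewrite big_ord0.
by rewrite big_ord_recl /= N1 big1 ?addr0 // => i _; rewrite /delta0 /= N0.
Qed.

Lemma has_sum_delta0 : has_sum (delta0 K) 1.
Proof.
move=> e e0; exists 1%N => -[//|n] _.
rewrite big_ord_recl /= big1 ?addr0 ?subrr ?N0 ?ltW // => i _.
Qed.

Lemma l1_oneminus w : l1bd (oneminus w) (1 + N w).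
Proof.
have h := N_ge0 w.
case=> [|[|n]]; first by rewrite big_ord0; lra.
  by rewrite big_ord1 /= N1; lra.
rewrite !big_ord_recl /= N1 mulr1n NN big1 ?addr0 // => i _.
by rewrite mulr0n oppr0 N0.
Qed.

Lemma has_sum_oneminus w : has_sum (oneminus w) (1 - w).
Proof.
move=> e e0; exists 2%N => -[//|[//|n]] _.
rewrite !big_ord_recl /= big1 ?addr0 ?mulr1n ?subrr ?N0 ?ltW // => i _.
by rewrite mulr0n oppr0.
Qed.

Lemma has_sum_convn a A s k : l1bd a A -> has_sum a s -> has_sum (convn a k) (s ^+ k).
Proof.
move=> ha hs; elim: k => [|k ih]; first exact: has_sum_delta0.
by rewrite exprS; apply: has_sum_conv ha hs ih.
Qed.

Lemma l1_convn a A k : l1bd a A -> l1bd (convn a k) (A ^+ k).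
Proof.
move=> ha; elim: k => [|k ih]; first exact: l1_delta0.
by rewrite exprS; apply: l1_conv.
Qed.

Lemma N_X x n : N (x ^+ n) = N x ^+ n.
Proof. by elim: n => [|n ih]; rewrite ?expr0 // !exprS NM ih. Qed.

Lemma l1_twist w a A : l1bd a A -> N w <= 1 -> l1bd (twist w a) A.
Proof.
move=> ha w1 n; apply: le_trans (ha n); apply: ler_sum => i _.
by rewrite NM N_X ler_piMr // exprn_ile1.
Qed.

Lemma l1_ext a b A : a =1 b -> l1bd a A -> l1bd b A.
Proof. by move=> e; have -> : a = b by apply/funext. Qed.

End Norms.

(** * Complex power series on the closed unit disc *)

Local Notation normc := (@ComplexField.Normc.normc _).

Section ComplexSeries.
Variable R : realType.
Local Open Scope complex_scope.
Local Notation C := R[i].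
Implicit Types (a b e f z : nat -> C) (w u v : C).

Lemma normr_absv : absolute_value (@Num.norm R R).
Proof.
split=> //; [exact: normr0|exact: normr1|exact: normrM|exact: ler_normD|exact: normrN].
Qed.

Lemma normc_ge0 w : 0 <= normc w.
Proof. by case: w => x y; rewrite /normc sqrtr_ge0. Qed.

Lemma normc_absv : absolute_value (normc : C -> R).
Proof.
split; [exact: ComplexField.Normc.normc0|exact: ComplexField.Normc.normc1|exact: normc_ge0
  |exact: ComplexField.Normc.normcM|exact: le_normcD|exact: normcN].
Qed.
Local Notation NA := normc_absv.

Lemma normc_real (x : R) : normc x%:C = `|x|.
Proof. by rewrite /normc /= expr0n addr0 sqrtr_sqr. Qed.

Lemma normc_conj w : normc w^* = normc w.
Proof. by case: w => x y; rewrite /normc /= sqrrN. Qed.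

Lemma normc_sq w : (normc w ^+ 2)%:C = w * w^*.
Proof. by rewrite -sqr_normc rmorphXn. Qed.

Lemma normc_Re_Im (x y : R) : normc (x +i* y) <= `|x| + `|y|.
Proof.
have -> : x +i* y = x%:C + 'i%C * y%:C by simpc.
apply: le_trans (absD NA _ _) _; rewrite (absM NA) !normc_real.
by rewrite /(normc 'i%C) /= expr0n add0r expr1n sqrtr1 mul1r.
Qed.

Lemma Re_le_normc w : `|complex.Re w| <= normc w.
Proof. by rewrite -lecR; exact: normc_ge_Re. Qed.

Lemma Im_le_normc w : `|complex.Im w| <= normc w.
Proof. by case: w => x y /=; rewrite -sqrtr_sqr ler_wsqrtr // lerDr sqr_ge0. Qed.

Lemma real_l1_has_sum (a : nat -> R) A : l1bd Num.norm a A -> exists s, has_sum Num.norm a s.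
Proof.
move=> ha.
have /normed_cvg/cvg_ex[s /cvgrPdist_le hs] : cvgn [normed series a].
  apply: nondecreasing_is_cvgn.
    by apply: nondecreasing_series => k _ _; apply: normr_ge0.
  by exists A => _ [n _ <-] /=; rewrite /series /= big_mkord; apply: ha.
exists s => e e0; have [n0 _ hn] := hs _ e0; exists n0 => n k.
by have := hn n k; rewrite /series /= big_mkord distrC.
Qed.

Lemma l1_has_sum a A : l1bd normc a A -> exists s, has_sum normc a s.
Proof.
move=> ha.
have [|x hx] := @real_l1_has_sum (fun n => complex.Re (a n)) A.
  by move=> n; apply: le_trans (ha n); apply: ler_sum => i _; apply: Re_le_normc.
have [|y hy] := @real_l1_has_sum (fun n => complex.Im (a n)) A.
  by move=> n; apply: le_trans (ha n); apply: ler_sum => i _; apply: Im_le_normc.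
exists (x +i* y) => e e0; have e2 : 0 < e / 2 by lra.
have [n1 h1] := hx _ e2; have [n2 h2] := hy _ e2.
exists (maxn n1 n2) => n; rewrite geq_max => /andP[/h1 k1 /h2 k2].
have -> : \sum_(i < n) a i = (\sum_(i < n) complex.Re (a i)) +i* (\sum_(i < n) complex.Im (a i)).
  rewrite -!(raddf_sum (@complex.Re R)) -!(raddf_sum (@complex.Im R)).
  by case: (\sum_(i < n) a i).
by simpc; apply: le_trans (normc_Re_Im _ _) _; lra.
Qed.

Lemma primitive_root_exists n : (0 < n)%N -> exists z : C, n.-primitive_root z.
Proof.
move=> n0; have [r Dr] := closed_field_poly_normal ('X^n - 1 : {poly C}).
rewrite (monicP (monicXnsubC _ n0)) scale1r in Dr.
suff /hasP[z _ hz] : has n.-primitive_root r by exists z.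
apply: has_prim_root => //.
- by apply/allP => x; rewrite -root_prod_XsubC -Dr.
- by rewrite -separable.separable_prod_XsubC -Dr separable_Xn_sub_1 // pnatr_eq0 -lt0n.
- by rewrite -ltnS -(size_prod_XsubC r id) -Dr size_XnsubC.
Qed.

(** Expanding the squares, the pair [(k, l)] carries the sum over [j] of [y^j] with
    [y = z^k conj(z)^l], an [n]-th root of unity that differs from 1 unless [k = l]; only the
    diagonal survives. *)
Lemma finite_parseval n (z : C) (x : nat -> C) : (0 < n)%N -> n.-primitive_root z ->
  \sum_(j < n) normc (\sum_(k < n) x k * (z ^+ j) ^+ k) ^+ 2
  = n%:R * \sum_(k < n) normc (x k) ^+ 2.
Proof.
move=> n0 hz; apply: (@complexI R).
have zn : z ^+ n = 1 := prim_expr_order hz.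
have z1 : normc z = 1.
  apply/eqP; rewrite -(@pexpr_eq1 _ (normc z) n) //; last exact: normc_ge0.
  by rewrite -(N_X NA) zn (abs1 NA).
have zz : z * z^* = 1 by rewrite -normc_sq z1 expr1n.
rewrite rmorph_sum rmorphM rmorph_nat rmorph_sum /=.
under eq_bigr => j _.
  rewrite normc_sq rmorph_sum big_distrlr /=; over.
rewrite exchange_big mulr_sumr /=; apply: eq_bigr => k _.
rewrite exchange_big (bigD1 k) //= [X in _ + X]big1 ?addr0 => [|l lk].
  rewrite normc_sq mulr_natl -[X in _ *+ X]card_ord -sumr_const; apply: eq_bigr => j _.
  by rewrite rmorphM mulrACA -[X in _ * X]normc_sq !(N_X NA) z1 !expr1n mulr1.
pose y := z ^+ k * (z^*) ^+ l.
have yn : y ^+ n = 1.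
  have zcn : z^* ^+ n = 1 by rewrite -(rmorphXn (@conjc R)) /= zn rmorph1.
  by rewrite /y exprMn [(z ^+ k) ^+ n]exprAC [(z^* ^+ l) ^+ n]exprAC zcn zn !expr1n mulr1.
have y1 : y - 1 != 0.
  rewrite subr_eq0; apply: contra lk => /eqP y1.
  have : z ^+ k == z ^+ l.
    by apply/eqP; rewrite -[RHS]mul1r -y1 /y -mulrA -exprMn (mulrC z^*) zz expr1n mulr1.
  by rewrite (eq_prim_root_expr hz) !modn_small // => /eqP kl; apply/eqP/val_inj.
have : (y - 1) * \sum_(j < n) y ^+ j = 0 by rewrite -subrX1 yn subrr.
move/eqP; rewrite mulf_eq0 (negbTE y1) /= => /eqP ys.
transitivity (x k * (x l)^* * \sum_(j < n) y ^+ j); last by rewrite ys mulr0.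
rewrite mulr_sumr; apply: eq_bigr => j _.
rewrite rmorphM mulrACA; congr (_ * _).
by rewrite /y exprMn !rmorphXn -!exprM /= ![(_ * j)%N]mulnC.
Qed.

(** Bessel's inequality, with the mean over [m]-th roots of unity in the role of the integral over
    the circle. *)
Lemma bessel_l1 a A K : l1bd normc a A ->
  (forall w s, normc w = 1 -> has_sum normc (twist w a) s -> normc s <= K) ->
  forall n, \sum_(i < n) normc (a i) ^+ 2 <= K ^+ 2.
Proof.
move=> ha hK n; set S := \sum_(i < n) _.
have S0 : 0 <= S by apply: sumr_ge0 => i _; apply: sqr_ge0.
suff h : Num.sqrt S <= K.
  by rewrite -(sqr_sqrtr S0) lerXn2r // nnegrE ?sqrtr_ge0 // (le_trans _ h) ?sqrtr_ge0.
apply/ler_addgt0Pr => d d0.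
have [n0 hn] := l1_tail NA ha d0.
(* [m] exceeds [n], so that the sum to be bounded is part of Parseval's sum, and [n0], so that
   cutting the series at [m] costs at most [d] everywhere on the circle. *)
pose m := (maxn n n0).+1.
have [z hz] := primitive_root_exists (ltn0Sn (maxn n n0)).
have zn : normc z = 1.
  apply/eqP; rewrite -(@pexpr_eq1 _ (normc z) m) //; last exact: normc_ge0.
  by rewrite -(N_X NA) (prim_expr_order hz) (abs1 NA).
have key (w : C) : normc w = 1 -> normc (\sum_(k < m) a k * w ^+ k) <= K + d.
  move=> w1.
  have w1' : normc w <= 1 by rewrite w1.
  have [s hs] := l1_has_sum (l1_twist NA ha w1').
  have : normc (\sum_(k < m) twist w a k - s) <= d.
    apply: (has_sum_tail NA hs) => p; apply: le_trans (hn p).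
    rewrite [leLHS](eq_bigr (fun i => normc (a i))); last first.
      by move=> i _; rewrite (absM NA) (N_X NA) w1 expr1n mulr1.
    case: (leqP m p) => mp; last by rewrite big_geq ?sumr_ge0 // 1?ltnW // => *; apply: normc_ge0.
    rewrite [leRHS](big_cat_nat (n:=m)) //=; last by rewrite /m; lia.
    by rewrite lerDr sumr_ge0 // => *; apply: normc_ge0.
  have := hK w s w1 hs => k1 k2.
  have -> : \sum_(k < m) a k * w ^+ k = s + (\sum_(k < m) twist w a k - s).
    by rewrite addrC subrK.
  by apply: le_trans (absD NA _ _) _; lra.
have Kd : 0 <= K + d by apply: le_trans (key 1 (abs1 NA)); apply: normc_ge0.
have Sm : S <= \sum_(k < m) normc (a k) ^+ 2.
  rewrite /S -!(big_mkord xpredT (fun i => normc (a i) ^+ 2)).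
  rewrite [leRHS](big_cat_nat (n:=n)) //=; last by rewrite /m; lia.
  by rewrite lerDl sumr_ge0 // => *; apply: sqr_ge0.
rewrite -(@ler_pXn2r _ 2) ?nnegrE ?sqrtr_ge0 // sqr_sqrtr //.
apply: le_trans Sm _.
rewrite -(@ler_pM2l _ (m%:R : R)) ?ltr0Sn // -(finite_parseval _ _ hz) //.
rewrite mulr_natl -[X in _ *+ X]card_ord -sumr_const; apply: ler_sum => j _.
rewrite lerXn2r ?nnegrE ?normc_ge0 // key //.
by rewrite (N_X NA) zn expr1n.
Qed.



Lemma normc_subX w v n : normc w <= 1 -> normc v <= 1 ->
  normc (w ^+ n - v ^+ n) <= n%:R * normc (w - v).
Proof.
move=> w1 v1; elim: n => [|n ih]; first by rewrite subrr (abs0 NA) mul0r.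
have -> : w ^+ n.+1 - v ^+ n.+1 = w * (w ^+ n - v ^+ n) + (w - v) * v ^+ n by rewrite !exprS; ring.
apply: le_trans (absD NA _ _) _; rewrite !(absM NA) (N_X NA) -natr1 mulrDl mul1r.
have h1 := normc_ge0 (w - v); have h2 := normc_ge0 (w ^+ n - v ^+ n).
apply: lerD; first by apply: le_trans ih; rewrite ler_piMl.
by rewrite ler_piMr // exprn_ile1 // normc_ge0.
Qed.

(** Since [|w^n - v^n| <= n |w - v|] on the disc, the norms of the coefficients of [der f] add up to
    a Lipschitz constant. *)
Lemma twist_lipschitz f D w v s t : l1bd normc (der f) D ->
  normc w <= 1 -> normc v <= 1 ->
  has_sum normc (twist w f) s -> has_sum normc (twist v f) t ->
  normc (s - t) <= D * normc (w - v).
Proof.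
move=> hD w1 v1 hs ht.
have hst : tends normc (fun n => \sum_(i < n) twist w f i + (-1) * \sum_(i < n) twist v f i) (s + (-1) * t).
  by apply: (tendsD NA hs); apply: (tendsZ NA).
rewrite mulN1r in hst; apply: (tends_le NA hst) => n.
rewrite mulN1r -sumrB; apply: le_trans (N_sum NA _ _ _) _.
apply: le_trans (ler_wpM2r (normc_ge0 _) (hD n)); rewrite mulr_suml; apply: ler_sum => i _.
rewrite /twist -mulrBr (absM NA) /der (absM NA) mulrAC [leRHS]mulrC ler_wpM2l ?normc_ge0 //.
apply: le_trans (normc_subX _ w1 v1) _.
have -> : (i%:R : C) = (i%:R : R)%:C by rewrite rmorph_nat.
by rewrite normc_real normr_nat.
Qed.

Lemma unit_disc_compact : compact [set p : R * R | p.1 ^+ 2 + p.2 ^+ 2 <= 1].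
Proof.
have cB : compact ([set` `[-1, 1]] `*` [set` `[-1, 1]] : set (R * R)%type).
  by apply: compact_setX; apply: segment_compact.
apply: (subclosed_compact _ cB).
- have -> : [set p : R * R | p.1 ^+ 2 + p.2 ^+ 2 <= 1]
     = (fun p : R * R => p.1 ^+ 2 + p.2 ^+ 2) @^-1` [set x | x <= 1] by [].
  apply: closed_comp => [p _|]; last exact: closed_le.
  apply: (@cvgD _ _ (R * R)%type (nbhs p) _ (fun p => p.1 ^+ 2) (fun p => p.2 ^+ 2)).
    by rewrite expr2; apply: cvgM; apply: cvg_fst.
  by rewrite expr2; apply: cvgM; apply: cvg_snd.
- move=> [x y] /= h; rewrite !in_itv /= -!ler_norml.
  have [x2 y2] : x ^+ 2 <= 1 /\ y ^+ 2 <= 1.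
    by have := sqr_ge0 x; have := sqr_ge0 y; split; lra.
  by split; rewrite -sqrtr_sqr -sqrtr1 ler_wsqrtr.
Qed.

(** The value function is Lipschitz, so its modulus attains a minimum on the compact disc, and this
    minimum is not 0. The function [F] is produced by choice and carries information only for
    [normc w <= 1]. *)
Lemma bounded_below_on_disc f A D : l1bd normc f A -> l1bd normc (der f) D ->
  (forall w, normc w <= 1 -> ~ has_sum normc (twist w f) 0) ->
  exists2 k : R, 0 < k & forall w s, normc w <= 1 -> has_sum normc (twist w f) s -> k <= normc s.
Proof.
move=> hA hD nz.
have /choice[F hF] : forall w : C, exists s, normc w <= 1 -> has_sum normc (twist w f) s.
  move=> w; case: (boolP (normc w <= 1)) => [w1|_]; last by exists 0.
  by have [s hs] := l1_has_sum (l1_twist NA hA w1); exists s.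
pose B := [set p : R * R | p.1 ^+ 2 + p.2 ^+ 2 <= 1].
have BP (p : R * R) : B p -> normc (p.1 +i* p.2) <= 1.
  by move=> h; rewrite /normc -sqrtr1 ler_wsqrtr.
have D0 : 0 <= D by have := hD 0%N; rewrite big_ord0.
have [||c cB hc] := @compact_EVT_min _ R (fun p : R * R => normc (F (p.1 +i* p.2))) B _ unit_disc_compact.
- by exists (0, 0); rewrite /B /= expr0n addr0 ler01.
- apply/subspace_continuousP => p Bp; apply/cvgrPdist_le => e e0.
  have d0 : 0 < e / (2 * (D + 1)) by rewrite divr_gt0 //; lra.
  near=> t.
  have Bt : B t by near: t; rewrite near_withinE; near=> t.
  have [t1 t2] : ball p (e / (2 * (D + 1))) t.
    by near: t; apply: cvg_within; apply: nbhsx_ballx.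
  have k1 := hF _ (BP _ Bp); have k2 := hF _ (BP _ Bt).
  have h := twist_lipschitz hD (BP _ Bp) (BP _ Bt) k1 k2.
  apply: le_trans (_ : normc (F (p.1 +i* p.2) - F (t.1 +i* t.2)) <= _).
    set x := F _; set y := F _; rewrite ler_norml; apply/andP; split.
      have : normc y <= normc (- (x - y)) + normc x by apply: le_trans (absD NA _ _); rewrite opprB subrK.
      by rewrite (absN NA) lerNl opprB lerBlDr.
    have : normc x <= normc (x - y) + normc y by apply: le_trans (absD NA _ _); rewrite subrK.
    by rewrite lerBlDr.
  apply: le_trans h _.
  have : normc (p.1 +i* p.2 - (t.1 +i* t.2)) <= e / (D + 1).
    simpc; apply: le_trans (normc_Re_Im _ _) _.
    have -> : e / (D + 1) = e / (2 * (D + 1)) + e / (2 * (D + 1)) by field; lra.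
    by apply: lerD; apply/ltW.
  move=> h; apply: le_trans (ler_wpM2l D0 h) _.
  by rewrite mulrA ler_pdivrMr; nra.
exists (normc (F (c.1 +i* c.2))).
  rewrite lt_def normc_ge0 andbT; apply/eqP => /ComplexField.Normc.eq0_normc h.
  move/set_mem: cB => /BP c1; apply: (nz _ c1).
  by have := hF _ c1; rewrite h.
move=> w s w1 hs.
have -> : s = F w.
  by have := tends_uniq NA hs (hF _ w1) => /ComplexField.Normc.eq0_normc /eqP; rewrite subr_eq0 => /eqP.
have -> : w = (complex.Re w, complex.Im w).1 +i* (complex.Re w, complex.Im w).2 by case: (w).
apply: hc; apply/mem_set; rewrite /B /=.
move: w1; case: (w) => x y /= h.
have h0 : 0 <= x ^+ 2 + y ^+ 2 by rewrite addr_ge0 ?sqr_ge0.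
by rewrite -(sqr_sqrtr h0) expr_le1 // sqrtr_ge0.
Unshelve. all: by end_near.
Qed.

End ComplexSeries.

(** * Summability of the inverse series *)

Lemma sum_expr_le (R : realType) (r : R) n : 0 <= r -> r < 1 -> \sum_(i < n) r ^+ i <= (1 - r)^-1.
Proof.
move=> r0 r1; have d : 0 < 1 - r by lra.
rewrite -(ler_pM2l d) divff ?gt_eqF //.
have -> : (1 - r) * \sum_(i < n) r ^+ i = 1 - r ^+ n by rewrite -opprB mulNr -subrX1 opprB.
by have := exprn_ge0 n r0; lra.
Qed.

(** The induction runs on the sharper bound [2 - 1/(n+1)], because [1/(x+1)^2 <= 1/x - 1/(x+1)]. *)
Lemma sum_inv_sq_le (R : realType) n : \sum_(i < n) ((i.+1%:R : R) ^+ 2)^-1 <= 2.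
Proof.
suff h : \sum_(i < n.+1) ((i.+1%:R : R) ^+ 2)^-1 <= 2 - n.+1%:R^-1.
  apply: le_trans (_ : 2 - (n.+1%:R : R)^-1 <= _); last by rewrite gerBl invr_ge0.
  apply: le_trans h; rewrite big_ord_recr /= lerDl invr_ge0 sqr_ge0 //.
elim: n => [|n ih]; first by rewrite big_ord1 expr1n invr1; lra.
rewrite big_ord_recr /=; apply: le_trans (lerD ih (lexx _)) _.
set x : R := n.+1%:R; have x0 : 0 < x by rewrite ltr0Sn.
have -> : n.+2%:R = x + 1 :> R by rewrite /x -natr1.
have -> : 2 - x^-1 + ((x + 1) ^+ 2)^-1 = 2 - (x + 1)^-1 - (x * (x + 1) ^+ 2)^-1.
  by field; apply/andP; split; lra.
by rewrite gerBl invr_ge0 mulr_ge0 ?sqr_ge0 // ltW.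
Qed.

(** Arithmetic of the 3-4-1 argument. With [h = 1 - r], the [x]s are the moduli of [Z] at [r],
    [r u], [r conj(u)], [r u^2], [r conj(u)^2], and the [y]s those of [1 - w] at the last four
    points. The pole costs [h^-6], the two supposed zeros give [h^8], which leaves [h^2]; the
    exponent 10 is [4 + 4 + 1 + 1], the number of factors [y]. *)
Lemma product_squeeze (R : realType) (A D h T x1 x2 x3 x4 x5 y2 y3 y4 y5 : R) :
  0 <= T -> 0 < h -> 0 <= D -> 0 <= x1 -> 0 <= x2 -> 0 <= x3 -> 0 <= x4 -> 0 <= x5 ->
  T <= y2 -> T <= y3 -> T <= y4 -> T <= y5 ->
  1 <= x1 ^+ 6 * ((x2 * x3) ^+ 4 * (x4 * x5)) ->
  h * x1 <= A -> y2 * x2 <= D * h -> y3 * x3 <= D * h -> y4 * x4 <= A -> y5 * x5 <= A ->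
  T ^+ 10 <= A ^+ 6 * D ^+ 8 * A ^+ 2 * h ^+ 2.
Proof.
move=> T0 h0 D0 p1 p2 p3 p4 p5 L2 L3 L4 L5 G1 U1 U2 U3 U4 U5.
have q2 := le_trans T0 L2; have q3 := le_trans T0 L3.
have q4 := le_trans T0 L4; have q5 := le_trans T0 L5.
have Dh : 0 <= D * h by rewrite mulr_ge0 // ltW.
have h0' := ltW h0.
have A0 : 0 <= A by apply: le_trans U1; rewrite mulr_ge0.
have e4 : 0 <= T ^+ 4 by rewrite exprn_ge0.
have ey2 : T ^+ 4 <= y2 ^+ 4 by rewrite lerXn2r.
have ey3 : T ^+ 4 <= y3 ^+ 4 by rewrite lerXn2r.
have ey : T ^+ 10 <= y2 ^+ 4 * y3 ^+ 4 * (y4 * y5).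
  have -> : T ^+ 10 = T ^+ 4 * T ^+ 4 * (T * T) by ring.
  apply: ler_pM; [exact: mulr_ge0|exact: mulr_ge0|exact: ler_pM|exact: ler_pM].
have P0 : 0 <= x1 ^+ 6 * ((x2 * x3) ^+ 4 * (x4 * x5)) by exact: le_trans ler01 G1.
have Y0 : 0 <= T ^+ 10 by rewrite exprn_ge0.
rewrite -(ler_pM2l (exprn_gt0 6 h0)).
have -> : h ^+ 6 * (A ^+ 6 * D ^+ 8 * A ^+ 2 * h ^+ 2)
   = A ^+ 6 * ((D * h) ^+ 4 * (D * h) ^+ 4 * (A * A)) by ring.
apply: le_trans (_ : (h * x1) ^+ 6 * ((y2 * x2) ^+ 4 * (y3 * x3) ^+ 4 * ((y4 * x4) * (y5 * x5))) <= _).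
  have -> : (h * x1) ^+ 6 * ((y2 * x2) ^+ 4 * (y3 * x3) ^+ 4 * ((y4 * x4) * (y5 * x5)))
      = h ^+ 6 * (y2 ^+ 4 * y3 ^+ 4 * (y4 * y5) * (x1 ^+ 6 * ((x2 * x3) ^+ 4 * (x4 * x5)))) by ring.
  by rewrite ler_wpM2l ?exprn_ge0 // -[leLHS]mulr1 ler_pM.
apply: ler_pM; [by rewrite exprn_ge0 // mulr_ge0| |by rewrite lerXn2r // nnegrE mulr_ge0|].
  by apply: mulr_ge0; apply: mulr_ge0; rewrite ?exprn_ge0 // mulr_ge0.
apply: ler_pM; [| | |exact: ler_pM (mulr_ge0 _ _) (mulr_ge0 _ _) U4 U5].
- by apply: mulr_ge0; rewrite exprn_ge0 // mulr_ge0.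
- by apply: mulr_ge0; rewrite mulr_ge0.
- by apply: ler_pM; rewrite ?exprn_ge0 ?mulr_ge0 // lerXn2r // nnegrE mulr_ge0.
Qed.

Section Inverse.
Variable R : realType.
Local Open Scope complex_scope.
Local Notation C := R[i].
Implicit Types (a b e f z : nat -> C) (w u v : C).
Local Notation NA := (normc_absv R).

Lemma bounded_twist_l1 a B w (r : R) : (forall n, normc (a n) <= B) ->
  normc w <= r -> r < 1 -> l1bd normc (twist w a) (B / (1 - r)).
Proof.
move=> ha wr r1 n; have r0 : 0 <= r by apply: le_trans wr; apply: normc_ge0.
have B0 : 0 <= B by apply: le_trans (ha 0%N); apply: normc_ge0.
apply: le_trans (ler_wpM2l B0 (sum_expr_le n r0 r1)); rewrite mulr_sumr.
apply: ler_sum => i _; rewrite (absM NA) (N_X NA) ler_pM ?exprn_ge0 ?normc_ge0 //.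
by rewrite lerXn2r // nnegrE normc_ge0.
Qed.

(** A bounded [e] is summable strictly inside the disc, where the product of the two values must be
    1. *)
Lemma nonzero_inside e f A B w : l1bd normc f A -> (forall n, normc (e n) <= B) ->
  conv e f = delta0 _ -> normc w < 1 -> ~ has_sum normc (twist w f) 0.
Proof.
move=> fA eB ef w1 hf.
have le := bounded_twist_l1 eB (lexx _) w1.
have [t ht] := l1_has_sum le.
have := has_sum_conv NA le ht hf; rewrite twist_conv ef twist_delta0 mulr0 => h.
have := tends_uniq NA h (has_sum_delta0 NA); rewrite sub0r (absN NA) (abs1 NA).
by move/eqP; rewrite oner_eq0.
Qed.

(** Differentiate [e * f = 1] and multiply by [e]: the formal version of [(1/F)' = - F' / F^2]. *)
Lemma der_inverse e f : conv e f = delta0 _ ->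
  der e = (fun n => (-1) * conv (conv e e) (der f) n).
Proof.
move=> ef.
have k : conv (der e) f = (fun n => (-1) * conv e (der f) n).
  apply/funext => n; have := congr1 (fun g => g n) (der_conv e f).
  rewrite ef /der /delta0 => /esym.
  have -> : n%:R * (n == 0)%:R = 0 :> C by case: n => [|n]; rewrite ?mul0r ?mulr0.
  by move/eqP; rewrite addr_eq0 mulN1r => /eqP.
rewrite -[LHS]conv0d -ef convC (convC e) convA k convZl; apply/funext => n.
by congr (_ * _); rewrite -convA (convC (der f)) convA.
Qed.

(* On the circle of radius r < 1 the function E = 1/F satisfies
   w E' = - E^2 (w F'), which is bounded independently of r; by Bessel's inequality
   the sum of n^2 |e_n|^2 is finite, and Cauchy-Schwarz gives the sum of |e_n|. *)
Lemma l1_inverse e f A D B : l1bd normc f A -> l1bd normc (der f) D ->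
  (forall w, normc w <= 1 -> ~ has_sum normc (twist w f) 0) ->
  conv e f = delta0 _ -> (forall n, normc (e n) <= B) -> exists E, l1bd normc e E.
Proof.
move=> fA fD nz ef eB.
have [k k0 hk] := bounded_below_on_disc fA fD nz.
have D0 : 0 <= D by have := fD 0%N; rewrite big_ord0.
(* [|F| >= k] gives [|1/F| <= 1/k], and [D] bounds [w F']. *)
pose M := (k ^-2 * D) ^+ 2.
have sq n (r : R) : 0 < r -> r < 1 -> \sum_(i < n) normc (der (twist r%:C e) i) ^+ 2 <= M.
  move=> r0 r1; have rr : normc r%:C <= r by rewrite normc_real gtr0_norm.
  have rr1 : normc r%:C <= 1 by apply: le_trans rr _; apply: ltW.
  have le := bounded_twist_l1 eB rr r1.
  have eftw : conv (twist r%:C e) (twist r%:C f) = delta0 _ by rewrite twist_conv ef twist_delta0.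
  have dfE : der (twist r%:C f) = twist r%:C (der f).
    by apply/funext => m; rewrite /der /twist mulrA.
  have ldf : l1bd normc (der (twist r%:C f)) D by rewrite dfE; apply: (l1_twist NA).
  have lde : l1bd normc (der (twist r%:C e)) (1 * ((B / (1 - r) * (B / (1 - r))) * D)).
    rewrite (der_inverse eftw) => m.
    rewrite mul1r; apply: le_trans (l1_conv NA (l1_conv NA le le) ldf m).
    by apply: ler_sum => i _; rewrite (absM NA) (absN NA) (abs1 NA) mul1r.
  apply: (bessel_l1 lde) => w s w1 hs.
  have w1' : normc w <= 1 by rewrite w1.
  have lew := l1_twist NA le w1'.
  have [t ht] := l1_has_sum lew.
  have lfw := l1_twist NA (l1_twist NA fA rr1) w1'.
  have [x hx] := l1_has_sum lfw.
  have ldw := l1_twist NA ldf w1'.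
  have [y hy] := l1_has_sum ldw.
  have tx : t * x = 1.
    have := has_sum_conv NA lew ht hx; rewrite twist_conv eftw twist_delta0 => h.
    have /ComplexField.Normc.eq0_normc/eqP := tends_uniq NA h (has_sum_delta0 NA).
    by rewrite subr_eq0 => /eqP.
  have -> : s = (-1) * (t * t * y).
    have h1 := has_sum_conv NA (l1_conv NA lew lew) (has_sum_conv NA lew ht ht) hy.
    have h2 := tendsZ NA (-1) h1.
    have h3 : has_sum normc (twist w (der (twist r%:C e))) ((-1) * (t * t * y)).
      apply: eq_tends h2 => m /=; rewrite mulr_sumr; apply: eq_bigr => i _.
      by rewrite (der_inverse eftw) !twist_conv /twist mulrA.
    have /ComplexField.Normc.eq0_normc/eqP := tends_uniq NA hs h3.
    by rewrite subr_eq0 => /eqP.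
  rewrite !(absM NA) (absN NA) (abs1 NA) mul1r.
  have xk : k <= normc x.
    apply: (hk (r%:C * w)); first by rewrite (absM NA) w1 mulr1.
    by rewrite -twistM.
  have tk : normc t <= k^-1.
    rewrite -(ler_pM2r k0) mulVf ?gt_eqF //.
    by apply: le_trans (ler_wpM2l (normc_ge0 _) xk) _; rewrite -(absM NA) tx (abs1 NA).
  rewrite -exprVn expr2; apply: ler_pM; rewrite ?mulr_ge0 ?normc_ge0 //.
    by apply: ler_pM; rewrite ?normc_ge0.
  exact: (has_sum_le NA ldw hy).
have sq1 n : \sum_(i < n) normc (der e i) ^+ 2 <= M.
  set S := \sum_(i < n) _; have S0 : 0 <= S by apply: sumr_ge0 => i _; apply: sqr_ge0.
  apply/ler_addgt0Pr => d d0.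
  (* Passage to [r = 1]: with [r = 1 - h], Bernoulli gives [r^(2i) >= 1 - 2 n h] for [i < n], and
     [h] is so small that the loss is at most [d]. *)
  pose h := Num.min (1 / 2) (d / ((n * 2)%:R * S + 1)) : R.
  have nS : 0 <= (n * 2)%:R * S by rewrite mulr_ge0.
  have h0 : 0 < h by rewrite lt_min; apply/andP; split; [lra|rewrite divr_gt0 //; lra].
  have h12 : h <= 1 / 2 by rewrite ge_min lexx.
  have hd : h * ((n * 2)%:R * S) <= d.
    apply: le_trans (_ : h * ((n * 2)%:R * S + 1) <= _); first by rewrite ler_wpM2l ?ltW //; lra.
    by rewrite -ler_pdivlMr ?ge_min ?lexx ?orbT //; lra.
  have r0 : 0 < 1 - h by lra.
  have r1 : 1 - h < 1 by lra.
  have bern m : 1 - m%:R * h <= (1 - h) ^+ m.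
    elim: m => [|m ih]; first by rewrite mul0r subr0.
    rewrite exprS -natr1; apply: le_trans (ler_wpM2l (ltW r0) ih).
    by have : 0 <= m%:R :> R by []; nra.
  have := sq n _ r0 r1; have : (1 - (n * 2)%:R * h) * S <= \sum_(i < n) normc (der (twist (1 - h)%:C e) i) ^+ 2.
    apply: le_trans (ler_wpM2r S0 (bern (n * 2)%N)) _; rewrite mulr_sumr; apply: ler_sum => i _.
    have -> : der (twist (1 - h)%:C e) i = (1 - h)%:C ^+ i * der e i.
      by rewrite /der /twist mulrA mulrC.
    rewrite (absM NA (_ ^+ _)) exprMn (N_X NA) normc_real gtr0_norm // -exprM ler_wpM2r ?sqr_ge0 //.
    apply: ler_wiXn2l; [lra|lra|].
    by rewrite leq_pmul2r // ltnW.
  have -> : (1 - (n * 2)%:R * h) * S = S - h * ((n * 2)%:R * S) by ring.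
  by lra.
exists (normc (e 0%N) + (M + 2)) => -[|n].
  by rewrite big_ord0 addr_ge0 ?normc_ge0 // addr_ge0 // sqr_ge0.
rewrite big_ord_recl lerD2l.
(* Cauchy-Schwarz in the termwise form [p s <= p^2 + s^2], with [p = i |e_i|] and [s = 1/i]. *)
apply: le_trans (_ : \sum_(i < n) (normc (der e i.+1) ^+ 2 + ((i.+1%:R : R) ^+ 2)^-1) <= _).
  apply: ler_sum => i _; rewrite /lift /= /bump /= add1n /der (absM NA).
  have -> : (i.+1%:R : C) = (i.+1%:R : R)%:C by rewrite rmorph_nat.
  rewrite normc_real normr_nat; set x : R := i.+1%:R; set y := normc _.
  have x0 : 0 < x by rewrite ltr0Sn.
  have yE : y = (x * y) * x^-1 by rewrite mulrAC divff ?mul1r ?gt_eqF.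
  rewrite -exprVn {1}yE; move: (x * y) (x^-1) => p s.
  by have := sqr_ge0 (p - s); have := sqr_ge0 p; have := sqr_ge0 s; rewrite sqrrB; lra.
rewrite big_split /= lerD ?sum_inv_sq_le //; apply: le_trans (sq1 n.+1).
by rewrite [leRHS]big_ord_recl lerDr sqr_ge0.
Qed.

(* The product of Z(r)^6, |Z(ru)|^8 and |Z(ru^2)|^2 has logarithmic derivative
   sum_k l_k |1 + u^k|^4 r^k, hence nonnegative coefficients, hence is >= 1 for r < 1;
   if F = (1 - w) Z vanished at u, it would tend to 0 as r tends to 1. *)
Lemma nonzero_on_circle z l f A D B u : logder z l -> (forall n, 0 <= l n) -> l 0%N = 0 ->
  z 0%N = 1 -> (forall n, normc (z n) <= B) -> f = conv (oneminus 1) z ->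
  l1bd normc f A -> l1bd normc (der f) D ->
  normc u = 1 -> u != 1 -> u ^+ 2 != 1 -> ~ has_sum normc (twist u f) 0.
Proof.
move=> zl l_ge0 l0 z0 zB fz fA fD u1 une u2ne hu0.
have u1' : normc u <= 1 by rewrite u1.
have uu : u * u^* = 1 by rewrite -normc_sq u1 expr1n.
have v1 : normc u^* = 1 by rewrite normc_conj.
have z_ge0 n : 0 <= z n by apply: (logder_ge0 zl) => //; rewrite z0 ler01.
have z_conj n : (z n)^* = z n.
  by have /complex_realP[x ->] := ger0_real (z_ge0 n); rewrite conjc_real.
have f_conj n : (f n)^* = f n.
  rewrite fz; case: n => [|n]; first by rewrite conv_oneminus0.
  by rewrite conv_oneminusS mul1r rmorphB /= !z_conj.
(* The coefficients are real, so [F] also vanishes at the conjugate of [u]; this is where the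
   exponent 8 comes from. *)
have hv0 : has_sum normc (twist u^* f) 0.
  move=> d /hu0[n0 hn]; exists n0 => n /hn; rewrite !subr0.
  rewrite -(normc_conj (\sum_(i < n) twist u f i)) rmorph_sum.
  congr (normc _ <= _); apply: eq_bigr => i _.
  by rewrite /twist rmorphM rmorphXn /= f_conj.
have D0 : 0 <= D by have := fD 0%N; rewrite big_ord0.
have A0 : 0 <= A by have := fA 0%N; rewrite big_ord0.
(* Distance of [u] and [u^2] from the pole; half of it is left for [r u] and [r u^2] once
   [h <= t / 2]. *)
pose t := Num.min (normc (1 - u)) (normc (1 - u ^+ 2)).
have t0 : 0 < t.
  by rewrite lt_min !lt_def !normc_ge0 !andbT; apply/andP; split; apply/eqP =>
    /ComplexField.Normc.eq0_normc/eqP; rewrite subr_eq0 eq_sym; apply/negP.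
pose K := A ^+ 6 * D ^+ 8 * A ^+ 2.
have K0 : 0 <= K by rewrite !mulr_ge0 ?exprn_ge0.
have key (h : R) : 0 < h -> h < 1 -> h <= t / 2 -> (t / 2) ^+ 10 <= K * h ^+ 2.
  move=> h0 h1 ht; pose r := 1 - h.
  have r0 : 0 < r by rewrite /r; lra.
  have r1 : r < 1 by rewrite /r; lra.
  have nr w : normc w = 1 -> normc (r%:C * w) = r.
    by move=> w1; rewrite (absM NA) w1 mulr1 normc_real gtr0_norm.
  have lz w : normc w = 1 -> l1bd normc (twist (r%:C * w) z) (B / (1 - r)).
    by move=> w1; apply: bounded_twist_l1 => //; rewrite nr.
  have val w : normc w = 1 -> exists2 s, has_sum normc (twist (r%:C * w) z) s
      & has_sum normc (twist (r%:C * w) f) ((1 - r%:C * w) * s).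
    move=> w1; have [s hs] := l1_has_sum (lz w w1); exists s => //.
    have := has_sum_conv NA (l1_oneminus NA (r%:C * w)) (has_sum_oneminus NA (r%:C * w)) hs.
    by rewrite -twist_oneminus twist_conv -fz.
  have n11 := abs1 NA.
  have nu2 : normc (u ^+ 2) = 1 by rewrite (N_X NA) u1 expr1n.
  have nv2 : normc (u^* ^+ 2) = 1 by rewrite (N_X NA) v1 expr1n.
  have [s1 hs1 F1] := val _ n11; have [s2 hs2 F2] := val _ u1; have [s3 hs3 F3] := val _ v1.
  have [s4 hs4 F4] := val _ nu2; have [s5 hs5 F5] := val _ nv2.
  have l1 := lz _ n11; have l2 := lz _ u1; have l3 := lz _ v1; have l4 := lz _ nu2; have l5 := lz _ nv2.
  have L w := logder_twist (r%:C * w) zl.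
  have Lg := logder_conv (logder_convn 6 (L 1)) (logder_conv (logder_convn 4 (logder_conv (L u) (L u^*)))
      (logder_conv (L (u ^+ 2)) (L (u^* ^+ 2)))).
  have Hg := has_sum_conv NA (l1_convn NA 6 l1) (has_sum_convn NA 6 l1 hs1)
    (has_sum_conv NA (l1_convn NA 4 (l1_conv NA l2 l3))
      (has_sum_convn NA 4 (l1_conv NA l2 l3) (has_sum_conv NA l2 hs2 hs3))
      (has_sum_conv NA l4 hs4 hs5)).
  move: Lg Hg; set g := conv _ (conv _ _) => Lg Hg.
  have g0 : g 0%N = 1.
    have c0 a b : conv a b 0%N = a 0%N * b 0%N by rewrite /conv big_ord1.
    have cn0 a k : convn a k 0%N = (a 0%N) ^+ k.
      by elim: k => [|k ih]; rewrite /convn /= ?expr0 // c0 exprS -ih.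
    by rewrite /g !(c0, cn0) /twist !z0 !expr0 !mulr1 !expr1n !mulr1.
  have g_ge0 n : 0 <= g n.
    apply: (logder_ge0 Lg); rewrite ?g0 ?ler01 //.
      by rewrite /twist l0 !(mul0r, mulr0, addr0).
    have tw w k : twist (r%:C * w) l k = l k * (r%:C ^+ k * w ^+ k) by rewrite /twist exprMn.
    move=> k; rewrite !tw.
    have rk : 0 <= r%:C ^+ k by rewrite exprn_ge0 // lecR ltW.
    pose x := u ^+ k; pose y := u^* ^+ k.
    have xy : x * y = 1 by rewrite /x /y -exprMn uu expr1n.
    have -> : (u ^+ 2) ^+ k = x ^+ 2 by rewrite exprAC.
    have -> : (u^* ^+ 2) ^+ k = y ^+ 2 by rewrite exprAC.
    rewrite -/x -/y expr1n.
    have yx : y = x^* by rewrite /x /y rmorphXn.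
    (* Origin of the exponents 6, 4, 1: for [x y = 1], [6 + 4 (x + y) + x^2 + y^2] is the square of
       [(1 + x)(1 + y)]. *)
    have -> : 6 * (l k * (r%:C ^+ k * 1)) + (4 * (l k * (r%:C ^+ k * x) + l k * (r%:C ^+ k * y)) +
        (l k * (r%:C ^+ k * x ^+ 2) + l k * (r%:C ^+ k * y ^+ 2)))
       = l k * r%:C ^+ k * ((1 + x) * (1 + y)) ^+ 2.
      have -> : ((1 + x) * (1 + y)) ^+ 2 = (2 + x + y + (x * y - 1)) ^+ 2 by ring.
      rewrite xy subrr addr0.
      have -> : (2 + x + y) ^+ 2 = 6 + 4 * (x + y) + (x ^+ 2 + y ^+ 2) + 2 * (x * y - 1) by ring.
      by rewrite xy subrr mulr0 addr0; ring.
    apply: mulr_ge0; [exact: mulr_ge0 | apply: exprn_ge0].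
    have -> : 1 + y = (1 + x)^* by rewrite rmorphD rmorph1 yx.
    by rewrite -normc_sq lecR sqr_ge0.
  (* The constant coefficient is 1 and the others are nonnegative, so every nonempty partial sum is
     at least 1. *)
  have G1 : 1 <= normc (s1 ^+ 6 * ((s2 * s3) ^+ 4 * (s4 * s5))).
    move: Hg; set G := s1 ^+ 6 * _ => Hg; apply/ler_addgt0Pr => d /Hg [n0 hn].
    have := hn n0.+1 (leqnSn _); set S := \sum_(i < n0.+1) g i => k.
    have S1 : 1 <= normc S.
      rewrite -lecR; have -> : (normc S)%:C = `|S| by [].
      rewrite ger0_norm ?sumr_ge0 // /S big_ord_recl g0 lerDl sumr_ge0 //.
    have : normc S <= normc (S - G) + normc G by apply: le_trans (absD NA _ _); rewrite subrK.
    by move: S1 k; set a1 := normc S; set a2 := normc (S - G); set a3 := normc G; lra.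
  have Fr w s : normc w = 1 -> has_sum normc (twist (r%:C * w) f) s -> normc s <= A.
    by move=> w1; apply: (has_sum_le NA (l1_twist NA fA _)); rewrite nr // ltW.
  have Fu w s : normc w = 1 -> has_sum normc (twist w f) 0 -> has_sum normc (twist (r%:C * w) f) s ->
      normc s <= D * h.
    move=> w1 hw hs; have a1 : normc (r%:C * w) <= 1 by rewrite nr // ltW.
    have a2 : normc w <= 1 by rewrite w1.
    have := twist_lipschitz fD a1 a2 hs hw.
    have -> : r%:C * w - w = (- h)%:C * w.
      by rewrite -{2}[w]mul1r -mulrBl -(rmorph1 (real_complex R)) -rmorphB /= /r; congr (_%:C * _); ring.
    by rewrite subr0 (absM NA) w1 mulr1 normc_real normrN gtr0_norm.
  have low w : normc w = 1 -> t <= normc (1 - w) -> t / 2 <= normc (1 - r%:C * w).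
    move=> w1 tw; have : normc (1 - w) <= normc (1 - r%:C * w) + h.
      have -> : 1 - w = (1 - r%:C * w) + (- h)%:C * w.
        have -> : (- h)%:C = r%:C - 1 by rewrite -(rmorph1 (real_complex R)) -rmorphB /= /r; congr (_%:C); ring.
        ring.
      apply: le_trans (absD NA _ _) _; rewrite (absM NA (_%:C)) w1 mulr1 normc_real normrN gtr0_norm //.
    move: tw; set a1 := normc (1 - w); set a2 := normc (1 - _); lra.
  have tu : t <= normc (1 - u) by rewrite ge_min lexx.
  have tu2 : t <= normc (1 - u ^+ 2) by rewrite ge_min lexx orbT.
  have cj w : normc (1 - w^*) = normc (1 - w) by rewrite -normc_conj rmorphB rmorph1 /= conjcK.
  have L2 := low _ u1 tu.
  have L3 : t / 2 <= normc (1 - r%:C * u^*) by apply: low => //; rewrite cj.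
  have L4 := low _ nu2 tu2.
  have L5 : t / 2 <= normc (1 - r%:C * (u^* ^+ 2)) by apply: low => //; rewrite -rmorphXn cj.
  have U1 := Fr _ _ n11 F1; have U2 := Fu _ _ u1 hu0 F2; have U3 := Fu _ _ v1 hv0 F3.
  have U4 := Fr _ _ nu2 F4; have U5 := Fr _ _ nv2 F5.
  have e1 : normc (1 - r%:C * 1) = h.
    by rewrite mulr1 -(rmorph1 (real_complex R)) -rmorphB normc_real gtr0_norm /r opprB addrC subrK.
  rewrite (absM NA) in U1; rewrite e1 in U1.
  rewrite (absM NA) in U2; rewrite (absM NA) in U3; rewrite (absM NA) in U4; rewrite (absM NA) in U5.
  rewrite (absM NA (_ ^+ _)) (absM NA (_ ^+ _) (_ * _)) !(N_X NA) (absM NA s2) (absM NA s4) in G1.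
  have t2 : 0 <= t / 2 by rewrite divr_ge0 // ltW.
  exact: (product_squeeze t2 h0 D0 (normc_ge0 _) (normc_ge0 _) (normc_ge0 _) (normc_ge0 _) (normc_ge0 _)
    L2 L3 L4 L5 G1 U1 U2 U3 U4 U5).
pose T := (t / 2) ^+ 10.
have T0 : 0 < T by rewrite exprn_gt0 //; lra.
(* The last bound gives [K h^2 <= (K + 1) h <= T / 2], against [T <= K h^2] from [key]. *)
pose h := Num.min (1 / 2) (Num.min (t / 2) (T / (2 * (K + 1)))) : R.
have h0 : 0 < h.
  rewrite !lt_min; apply/and3P; split; [lra|lra|].
  by rewrite divr_gt0 //; lra.
have hh : h <= 1 / 2 by rewrite ge_min lexx.
have ht : h <= t / 2 by rewrite !ge_min lexx orbT.
have hT : h <= T / (2 * (K + 1)) by rewrite !ge_min lexx !orbT.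
have h1 : h < 1 by lra.
have := key h h0 h1 ht; rewrite -/T.
have : K * h ^+ 2 <= (K + 1) * h.
  by apply: ler_pM => //; rewrite ?sqr_ge0 //; [lra|rewrite expr2; nra].
have : h * (2 * (K + 1)) <= T by rewrite -ler_pdivlMr //; lra.
by have : 0 < (K + 1) * h; [rewrite mulr_gt0 //; lra|lra].
Qed.

End Inverse.

(** * Counting in the free commutative monoid *)

Section Combinatorics.
Variables (R : realType) (P : countType) (deg : P -> nat).
Hypothesis deg_pos : forall p : P, (0 < deg p)%N.
Hypothesis deg_fin : forall x : nat, finite_set [set g : {mset P} | (degG deg g <= x)%N].
Implicit Types (g h r : {mset P}) (p : P) (s : seq P).
Local Notation degG := (degG deg).
Local Notation mu := (@mobius P R).

Lemma msetD_perm g h : perm_eq (msetD g h) ((g : seq P) ++ h).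
Proof.
have -> : msetD g h = seq_mset ((g : seq P) ++ h).
  by apply/msetP => x; rewrite mset_seqE count_cat !count_mem_mset msetE2.
exact: perm_eq_seq_mset.
Qed.

Lemma degGD g h : degG (msetD g h) = (degG g + degG h)%N.
Proof. by rewrite /Defs.degG (perm_big _ (msetD_perm g h)) big_cat. Qed.

Lemma degG0 : degG mset0 = 0%N.
Proof. by rewrite /Defs.degG big_mset0. Qed.

Lemma degG1 p : degG [mset p] = deg p.
Proof. by rewrite /Defs.degG enum_msetn big_seq1. Qed.

Lemma degG_sub h g : msubset h g -> degG g = (degG h + degG (msetB g h))%N.
Proof.
move=> /msubsetP hg; rewrite -degGD; congr Defs.degG; apply/msetP => x.
by rewrite !msetE2 subnKC.
Qed.

Lemma mset1_sub p g : msubset [mset p] g = (p \in g).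
Proof.
apply/msubsetP/idP => [/(_ p)|pg x]; first by rewrite msetnxx -in_mset.
by rewrite msetnE; case: eqP => // ->; rewrite -in_mset.
Qed.

Lemma mset1_subK p g : p \in g -> exists h, g = msetD [mset p] h.
Proof. by move=> /msetB1K <-; exists (msetB g [mset p]). Qed.

Lemma deg_le_degG p g : p \in g -> (deg p <= degG g)%N.
Proof. by move=> /mset1_subK[h ->]; rewrite degGD degG1 leq_addr. Qed.

Lemma mset0P g : reflect (forall p, p \notin g) (g == mset0).
Proof.
apply: (iffP eqP) => [-> p|h]; first by rewrite in_mset0.
by apply/msetP => x; rewrite mset0E; apply/mset_eq0P.
Qed.

Lemma mset_neq0P g : g != mset0 -> exists p, p \in g.
Proof.
move=> g0; apply: contrapT => h; move/negP: g0; apply.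
by apply/mset0P => p; apply/negP => pg; apply: h; exists p.
Qed.

Lemma degG_eq0 g : (degG g == 0%N) = (g == mset0).
Proof.
apply/eqP/eqP => [g0|->]; last exact: degG0.
apply/eqP/mset0P => p; apply/negP => /deg_le_degG; rewrite g0 leqNgt.
by rewrite deg_pos.
Qed.

Definition ofdeg n : seq {mset P} := fset_set [set g : {mset P} | degG g = n].

Lemma ofdeg_finite n : finite_set [set g : {mset P} | degG g = n].
Proof. by apply: sub_finite_set (deg_fin n) => g /= ->. Qed.

Lemma mem_ofdeg n g : (g \in ofdeg n) = (degG g == n).
Proof.
rewrite /ofdeg in_fset_set; last exact: ofdeg_finite.
by apply/idP/eqP => [/set_mem|/mem_set].
Qed.

Lemma ofdeg_uniq n : uniq (ofdeg n).
Proof. exact: fset_uniq. Qed.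

Definition primes_le n : seq P := fset_set [set p : P | (deg p <= n)%N].

Lemma primes_le_finite n : finite_set [set p : P | (deg p <= n)%N].
Proof.
have -> : [set p : P | (deg p <= n)%N]
    = (fun p => [mset p]) @^-1` [set g : {mset P} | (degG g <= n)%N].
  by apply/seteqP; split => p /=; rewrite degG1.
apply: finite_preimage (deg_fin n) => x y _ _ /(congr1 (fun g : {mset P} => g x)).
by rewrite msetnxx msetnE; case: eqP.
Qed.

Lemma mem_primes_le n p : (p \in primes_le n) = (deg p <= n)%N.
Proof.
rewrite /primes_le in_fset_set; last exact: primes_le_finite.
by apply/idP/idP => [/set_mem|/mem_set].
Qed.

Lemma primes_le_uniq n : uniq (primes_le n).
Proof. exact: fset_uniq. Qed.

Section Sums.
Variable V : nmodType.

(** [r |-> h + r] maps the elements of degree [n - deg h] bijectively onto the multiples of [h] of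
    degree [n]; the test guards against truncated subtraction. *)
Lemma sum_shift (F : {mset P} -> V) n h :
  \sum_(g <- ofdeg n | msubset h g) F g
  = if (degG h <= n)%N then \sum_(r <- ofdeg (n - degG h)) F (msetD h r) else 0.
Proof.
case: leqP => hn; last first.
  rewrite big_seq_cond big1 // => g /andP[]; rewrite mem_ofdeg => /eqP gn /degG_sub.
  by rewrite gn => e; move: hn; rewrite e ltnNge leq_addr.
rewrite -big_filter -(big_map (fun r => msetD h r) xpredT F); apply: perm_big.
apply: uniq_perm.
- exact: filter_uniq (ofdeg_uniq n).
- rewrite map_inj_uniq ?ofdeg_uniq // => x y e.
  by apply: (can_inj (msetDKB h)); rewrite e.
move=> g; rewrite mem_filter mem_ofdeg; apply/idP/mapP => [/andP[hg /eqP gn]|[r]].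
  exists (msetB g h); first by rewrite mem_ofdeg -gn (degG_sub hg) addKn.
  apply/msetP => x; rewrite !msetE2 subnKC //; exact: (msubsetP hg).
rewrite mem_ofdeg => /eqP rn ->; rewrite degGD rn subnKC // eqxx andbT.
by apply/msubsetP => x; rewrite !msetE2 leq_addr.
Qed.

Lemma sum_shift1 (F : {mset P} -> V) n p :
  \sum_(g <- ofdeg n | p \in g) F g
  = if (deg p <= n)%N then \sum_(r <- ofdeg (n - deg p)) F (msetD [mset p] r) else 0.
Proof. by rewrite -degG1 -sum_shift; apply: eq_bigl => g; rewrite mset1_sub. Qed.

Lemma sum_ofdeg0 (Q : pred {mset P}) (F : {mset P} -> V) :
  \sum_(g <- ofdeg 0 | Q g) F g = if Q mset0 then F mset0 else 0.
Proof.
have e : perm_eq (ofdeg 0) [:: mset0].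
  by apply: uniq_perm => [||g]; rewrite ?ofdeg_uniq // mem_ofdeg degG_eq0 inE.
by rewrite (perm_big _ e) /= big_cons big_nil addr0.
Qed.

End Sums.

Lemma squarefreeP g : reflect (forall p, g p <= 1)%N (squarefree g).
Proof.
apply: (iffP allP) => h p; last by move=> _; apply: h.
case: (boolP (p \in finsupp g)) => [/h//|].
by rewrite msuppE => /mset_eq0P ->.
Qed.

Lemma mobius0 : mu mset0 = 1.
Proof.
rewrite /mobius enum_mset0 expr0 ifT //; apply/squarefreeP => p.
by rewrite mset0E.
Qed.

Lemma mobiusD1 p h : mu (msetD [mset p] h) = if p \in h then 0 else - mu h.
Proof.
rewrite /mobius; have -> : size (msetD [mset p] h : seq P) = (size (h : seq P)).+1.
  by rewrite (perm_size (msetD_perm _ _)) size_cat enum_msetn.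
have [ph|ph] := boolP (p \in h).
  rewrite ifF //; apply/negP => /squarefreeP/(_ p).
  by rewrite mset1DE eqxx; move: ph; rewrite in_mset; case: (h p).
have -> : squarefree (msetD [mset p] h) = squarefree h.
  apply/squarefreeP/squarefreeP => H x; first by have := H x; rewrite mset1DE; lia.
  rewrite mset1DE; case: eqP => [->|_]; last by rewrite add0n.
  by rewrite (mset_eq0P ph).
by case: ifP; rewrite ?oppr0 // exprS mulN1r.
Qed.

Lemma mobius_norm_le1 g : `|mu g| <= 1.
Proof. by rewrite /mobius; case: ifP; rewrite ?normr0 // normrX normrN1 expr1n. Qed.

(** * Generating series by degree and Moebius inversion *)

Definition single (n : nat) : nat -> R := fun k => (k == n)%:R.
Definition sumdeg (Q : pred {mset P}) (F : {mset P} -> R) : nat -> R :=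
  fun n => \sum_(g <- ofdeg n | Q g) F g.

Lemma conv_single d (a : nat -> R) n :
  conv (single d) a n = if (d <= n)%N then a (n - d)%N else 0.
Proof.
rewrite /conv; case: leqP => dn.
  rewrite (bigD1 (Ordinal (_ : d < n.+1)%N)) //= /single eqxx mul1r big1 ?addr0 // => i id.
  by case: eqP => [e|]; rewrite ?mul0r //; case/negP: id; apply/eqP/val_inj.
rewrite big1 // => i _; rewrite /single; case: eqP => [e|]; rewrite ?mul0r //.
by have := ltn_ord i; rewrite e ltnS leqNgt dn.
Qed.

(** Elements without [p], then those of the form [p + h], whose series carries the factor
    [X^(deg p)]. Here [h] may still contain [p]. *)
Lemma sumdeg_split p (Q : pred {mset P}) F n :
  sumdeg Q F n = sumdeg (fun g => Q g && (p \notin g)) F n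
   + conv (single (deg p)) (sumdeg (fun h => Q (msetD [mset p] h)) (fun h => F (msetD [mset p] h))) n.
Proof.
rewrite /sumdeg (bigID (fun g => p \in g)) /= addrC; congr (_ + _).
rewrite conv_single.
under eq_bigl => g do rewrite andbC.
rewrite big_mkcondr sum_shift1; case: ifP => // _.
by rewrite [RHS]big_mkcond.
Qed.

Definition supported s : pred {mset P} := fun g => all (mem s) (g : seq P).
Definition avoids s : pred {mset P} := fun g => all (fun p => p \notin s) (g : seq P).

Lemma mset_allP (Q : pred P) g : reflect (forall p, p \in g -> Q p) (all Q (g : seq P)).
Proof. exact: allP. Qed.

Lemma all_msetD1 (Q : pred P) p h : all Q (msetD [mset p] h : seq P) = Q p && all Q (h : seq P).
Proof. by rewrite (perm_all _ (msetD_perm _ _)) all_cat enum_msetn /= andbT. Qed.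

Lemma sumdeg_avoids_cons p s n : p \notin s ->
  sumdeg (avoids (p :: s)) (fun=> 1) n =
  sumdeg (avoids s) (fun=> 1) n - conv (single (deg p)) (sumdeg (avoids s) (fun=> 1)) n.
Proof.
move=> ps; apply/eqP; rewrite -subr_eq opprK; apply/eqP.
rewrite [RHS](sumdeg_split p); congr (_ + _).
  apply: eq_bigl => g; apply/mset_allP/andP => [h|[/mset_allP h pg] x xg].
    split; last by apply/negP => /h; rewrite inE eqxx.
    by apply/mset_allP => x /h; rewrite inE negb_or => /andP[].
  by rewrite inE negb_or h // andbT; apply: contraNneq pg => <-.
apply: eq_conv => // i _; apply: eq_bigl => h.
by rewrite /avoids all_msetD1 ps.
Qed.

(** [mu(p + h)] vanishes when [p] divides [h], so [h] runs over elements supported on [s] alone; the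
    sign is [mu(p)]. *)
Lemma sumdeg_mobius_cons p s n : p \notin s ->
  sumdeg (supported (p :: s)) mu n =
  sumdeg (supported s) mu n - conv (single (deg p)) (sumdeg (supported s) mu) n.
Proof.
move=> ps; rewrite (sumdeg_split p); congr (_ + _).
  apply: eq_bigl => g; apply/andP/mset_allP => [[/mset_allP h pg] x xg|h].
    have /= := h x xg; rewrite inE => /orP[/eqP e|//].
    by move: pg; rewrite -e xg.
  split; first by apply/mset_allP => x xg /=; rewrite inE; have /= -> := h x xg; rewrite orbT.
  by apply/negP => /h /=; apply/negP.
rewrite !conv_single; case: ifP => _; rewrite ?oppr0 // /sumdeg -sumrN.
rewrite [LHS]big_mkcond [RHS]big_mkcond; apply: eq_bigr => h _.
rewrite mobiusD1 {1}/supported all_msetD1 /= inE eqxx /=.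
have [ph|ph] := boolP (p \in h).
  rewrite if_same ifF //; apply/negP => /mset_allP/(_ p ph) /=; exact/negP.
congr (if _ then _ else _); apply: eq_in_all => x xh /=; rewrite inE.
by case: eqP => // e; move: ph; rewrite -e xh.
Qed.

Definition card_deg : nat -> R := sumdeg xpredT (fun=> 1).

(* Adding a prime of degree d to [s] multiplies both generating series by [1 - w^d]. *)
Lemma mobius_inversion_list s : uniq s ->
  conv (sumdeg (supported s) mu) card_deg = sumdeg (avoids s) (fun=> 1).
Proof.
elim: s => [_|p s ih /= /andP[ps us]].
  have -> : sumdeg (supported [::]) mu = delta0 R.
    apply/funext => n; rewrite /sumdeg /delta0; case: eqP => [->|n0].
      by rewrite sum_ofdeg0 mobius0 ifT //; apply/mset_allP => p; rewrite in_mset0.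
    rewrite big_seq_cond big1 // => g /andP[]; rewrite mem_ofdeg => /eqP gn h.
    case: n0; rewrite -gn; apply/eqP; rewrite degG_eq0; apply/mset0P => p.
    by apply/negP; move: h => /mset_allP h /h.
  rewrite conv0d; apply/funext => n; apply: eq_bigl => g.
  by apply/esym/mset_allP.
have -> : sumdeg (supported (p :: s)) mu
   = fun n => sumdeg (supported s) mu n + (-1) * conv (single (deg p)) (sumdeg (supported s) mu) n.
  by apply/funext => n; rewrite mulN1r sumdeg_mobius_cons.
rewrite convDl convZl -convA ih //; apply/funext => n.
by rewrite sumdeg_avoids_cons // mulN1r.
Qed.

Definition rough m : pred {mset P} := fun g => all (fun p => m < deg p)%N (g : seq P).
Definition smooth m : pred {mset P} := fun g => all (fun p => deg p <= m)%N (g : seq P).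

(** In degrees up to [n] only primes of degree at most [n] occur, so coefficient [n] follows from
    the finite list of primes with [m < deg p <= n]; an element of degree [n] that avoids this list
    is [m]-smooth. *)
Lemma mobius_rough m :
  conv (sumdeg (rough m) mu) card_deg = sumdeg (smooth m) (fun=> 1).
Proof.
apply/funext => n; pose s := [seq p <- primes_le n | (m < deg p)%N].
have us : uniq s by rewrite filter_uniq ?primes_le_uniq.
have ms i g : (i <= n)%N -> g \in ofdeg i -> forall p, p \in g -> (p \in s) = (m < deg p)%N.
  move=> il; rewrite mem_ofdeg => /eqP gi p pg; rewrite mem_filter mem_primes_le.
  by rewrite (leq_trans (deg_le_degG pg)) ?gi // andbT.
transitivity (conv (sumdeg (supported s) mu) card_deg n).
  apply: eq_conv => // i il; rewrite /sumdeg big_seq_cond [RHS]big_seq_cond.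
  apply: eq_bigl => g; case: (boolP (g \in ofdeg i)) => //= gi.
  by apply: eq_in_all => p pg /=; rewrite (ms i g).
rewrite mobius_inversion_list // /sumdeg big_seq_cond [RHS]big_seq_cond.
apply: eq_bigl => g; case: (boolP (g \in ofdeg n)) => //= gi.
by apply: eq_in_all => p pg /=; rewrite (ms n g) // -leqNgt.
Qed.

Lemma sumdeg_smooth0 : sumdeg (smooth 0) (fun=> 1) = delta0 R.
Proof.
apply/funext => n; rewrite /sumdeg /delta0; case: eqP => [->|n0].
  by rewrite sum_ofdeg0 ifT //; apply/mset_allP => p; rewrite in_mset0.
rewrite big_seq_cond big1 // => g /andP[]; rewrite mem_ofdeg => /eqP gn h.
case: n0; rewrite -gn; apply/eqP; rewrite degG_eq0; apply/mset0P => p.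
by apply/negP; move: h => /mset_allP h /h; rewrite leqNgt deg_pos.
Qed.

(** * Von Mangoldt function and the logarithmic derivative of the zeta series *)

Definition geom d : nat -> R := fun n => ((0 < n) && (d %| n))%N%:R.

(** [geom d] is the series [X^d / (1 - X^d)], and this is its defining equation. *)
Lemma geomE d : (0 < d)%N -> geom d = conv (single d) (fun n => delta0 R n + geom d n).
Proof.
move=> d0; apply/funext => n; rewrite conv_single /geom /delta0.
case: (leqP d n) => dn; last first.
  have -> : (0 < n)%N && (d %| n)%N = false by apply/negP => /andP[n0 /(dvdn_leq n0)]; rewrite leqNgt dn.
  by [].
rewrite subn_gt0 subn_eq0 dvdn_subl // [LHS]/=.
have -> : (0 < n)%N by apply: leq_trans dn.
case: ltngtP dn => // [dn _|-> _]; first by rewrite add0r.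
by rewrite dvdnn addr0.
Qed.

(** Removing one copy of [p] from each multiple of [p] shows that the series [A] on the left
    satisfies [A = X^(deg p) (Z + A)], the equation that [geomE] gives for the right-hand side; it
    determines the coefficients recursively. *)
Lemma sum_multiplicity p : (fun n => \sum_(g <- ofdeg n) (g p)%:R) = conv (geom (deg p)) card_deg.
Proof.
apply/funext; elim/ltn_ind => n ih.
rewrite geomE // -convA conv_single convDl conv0d.
transitivity (\sum_(g <- ofdeg n | p \in g) ((g p)%:R : R)).
  rewrite [RHS]big_mkcond; apply: eq_bigr => g _.
  by case: ifP => // /negbT/mset_eq0P ->.
rewrite sum_shift1; case: ifP => // dn; rewrite -ih; last by have := deg_pos p; lia.
rewrite -big_split; apply: eq_bigr => g _.
by rewrite mset1DE eqxx natrD.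
Qed.

(** Von Mangoldt function summed over degree [n]: each multiple [k p] of degree [n], [k >= 1],
    contributes [deg p]. *)
Definition mangoldt : nat -> R := fun n => \sum_(p <- primes_le n) (deg p)%:R * geom (deg p) n.

Lemma sum_primes_le_widen (V : nmodType) n N (F : P -> V) : (n <= N)%N ->
  (forall p, (n < deg p)%N -> F p = 0) ->
  \sum_(p <- primes_le n) F p = \sum_(p <- primes_le N) F p.
Proof.
move=> nN F0; rewrite [RHS](bigID (fun p => deg p <= n)%N) /= [X in _ + X]big1 ?addr0.
  rewrite -[RHS]big_filter; apply: perm_big; apply: uniq_perm.
  - exact: primes_le_uniq.
  - by rewrite filter_uniq ?primes_le_uniq.
  - move=> p; rewrite mem_filter !mem_primes_le; case: leqP => //= h.
    by rewrite (leq_trans h).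
by move=> p; rewrite -ltnNge => /F0.
Qed.

Lemma mangoldt_widen n N : (n <= N)%N ->
  mangoldt n = \sum_(p <- primes_le N) (deg p)%:R * geom (deg p) n.
Proof.
move=> nN; apply: sum_primes_le_widen => // p np.
by rewrite /geom; case: n np {nN} => [|n] np /=; rewrite ?mulr0 // gtnNdvd // mulr0.
Qed.

Lemma degG_sum g N : (degG g <= N)%N ->
  degG g = (\sum_(p <- primes_le N) g p * deg p)%N.
Proof.
move=> gN; rewrite /Defs.degG sum_mset.
rewrite [RHS](bigID (fun p => p \in g)) /= [X in (_ + X)%N]big1 ?addn0.
  rewrite -[RHS]big_filter; apply: perm_big; apply: uniq_perm; rewrite ?fset_uniq //.
  - by rewrite filter_uniq ?primes_le_uniq.
  - move=> p; rewrite mem_filter mem_primes_le msuppE; case: (boolP (p \in g)) => //= pg.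
    by rewrite (leq_trans (deg_le_degG pg)).
by move=> p /mset_eq0P ->.
Qed.

(** Double count of the total degree of all elements of degree [n]: it is [n] times their number,
    and also the sum over primes of [deg p] times total multiplicity, which [sum_multiplicity]
    evaluates. *)
Lemma logder_card_deg : logder card_deg mangoldt.
Proof.
apply/funext => n.
have -> : der card_deg n = \sum_(p <- primes_le n) (deg p)%:R * conv (geom (deg p)) card_deg n.
  rewrite /der /card_deg /sumdeg mulr_sumr.
  transitivity (\sum_(g <- ofdeg n) \sum_(p <- primes_le n) (deg p)%:R * (g p)%:R : R).
    rewrite big_seq [RHS]big_seq; apply: eq_bigr => g; rewrite mem_ofdeg => /eqP gn.
    rewrite mulr1 -{1}gn (@degG_sum g n) ?gn // natr_sum; apply: eq_bigr => p _.
    by rewrite natrM mulrC.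
  rewrite exchange_big; apply: eq_bigr => p _; rewrite -mulr_sumr; congr (_ * _).
  exact: (congr1 (fun u => u n) (sum_multiplicity p)).
rewrite /conv; under eq_bigr => p _ do rewrite mulr_sumr.
rewrite exchange_big; apply: eq_bigr => i _.
rewrite (@mangoldt_widen i n) -1?ltnS // mulr_suml; apply: eq_bigr => p _.
by rewrite mulrA.
Qed.

Lemma mangoldt_ge0 n : 0 <= mangoldt n.
Proof. by apply: sumr_ge0 => p _; rewrite mulr_ge0. Qed.

Lemma mangoldt0 : mangoldt 0 = 0.
Proof. by rewrite /mangoldt big1 // => p _; rewrite /geom mulr0. Qed.

Definition primes_of (S : set P) n : R := \sum_(p <- primes_le n | `[< S p >] && (deg p == n)) 1.

Lemma primes_of_ge0 S n : 0 <= primes_of S n.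
Proof. exact: sumr_ge0. Qed.

(** Keeps the terms [k = 1]; together with the boundedness of the scaled [mangoldt] it yields
    Chebyshev's bound. *)
Lemma mangoldt_ge n : n%:R * primes_of setT n <= mangoldt n.
Proof.
rewrite /primes_of mulr_sumr /mangoldt [leLHS]big_mkcond; apply: ler_sum => p _.
case: ifP => [/andP[_ /eqP <-]|_]; last by rewrite mulr_ge0.
by rewrite /geom deg_pos dvdnn mulr1.
Qed.

Lemma sum_by_degree (S : set P) n (F : nat -> R) :
  \sum_(p <- primes_le n | `[< S p >]) F (deg p) = \sum_(m < n.+1) primes_of S m * F m.
Proof.
rewrite big_seq_cond (partition_big (fun p => inord (deg p) : 'I_n.+1) xpredT) //=.
apply: eq_bigr => m _; rewrite /primes_of mulr_suml.
transitivity (\sum_(p <- primes_le n | `[< S p >] && (deg p == m)) F m).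
  rewrite [RHS]big_seq_cond; apply: eq_big => [p|p].
    rewrite mem_primes_le; case: leqP => //= pn; congr (_ && _).
    by rewrite -(inj_eq val_inj) /= inordK.
  by move=> /andP[/andP[]]; rewrite mem_primes_le => pn _ /eqP <-; rewrite inordK.
rewrite big_mkcond -(@sum_primes_le_widen _ m) -1?ltnS //.
  by rewrite -big_mkcond; apply: eq_bigr => p _; rewrite mul1r.
by move=> p mp; case: eqP => [e|]; rewrite ?andbF //; move: mp; rewrite e ltnn.
Qed.

(** * Primes of maximal degree *)

Definition top g p := (p \in g) && smooth (deg p) g.

Lemma sum_top p n : \sum_(g <- ofdeg n | top g p) (1 : R)
  = conv (single (deg p)) (sumdeg (smooth (deg p)) (fun=> 1)) n.
Proof.
rewrite conv_single /top.
rewrite (big_mkcondr _ _ (fun g => p \in g)) sum_shift1; case: ifP => // _.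
rewrite /sumdeg [RHS]big_mkcond; apply: eq_bigr => h _.
by rewrite /smooth all_msetD1 leqnn.
Qed.

Lemma exists_top g : g != mset0 -> exists p, top g p.
Proof.
move=> /mset_neq0P[p0 pg0].
have [p _ pm] := @arg_maxnP (seq_sub (g : seq P)) (SeqSub pg0) xpredT (fun x => deg (ssval x)) isT.
exists (ssval p); rewrite /top (valP p); apply/mset_allP => x xg.
exact: (pm (SeqSub xg)).
Qed.

Lemma mset2_sub p p' g : p != p' ->
  msubset (msetD [mset p] [mset p']) g = (p \in g) && (p' \in g).
Proof.
move=> pp; apply/msubsetP/andP => [h|[pg pg'] x].
  by split; rewrite in_mset; [have := h p|have := h p'];
    rewrite mset1DE msetnE eqxx ?(negbTE pp) 1?eq_sym ?(negbTE pp).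
rewrite mset1DE msetnE; case: (eqVneq x p) => [->|_].
  by rewrite (negbTE pp) addn0 -in_mset.
by case: eqP => // ->; rewrite -in_mset.
Qed.

Lemma sum_top2 p p' n : p != p' -> deg p' = deg p ->
  \sum_(g <- ofdeg n | top g p && (p' \in g)) (1 : R)
  = conv (single (2 * deg p)) (sumdeg (smooth (deg p)) (fun=> 1)) n.
Proof.
move=> pp e; rewrite conv_single /top.
under eq_bigl => g do rewrite andbAC -mset2_sub //.
rewrite big_mkcondr sum_shift degGD !degG1 e addnn -mul2n; case: ifP => // _.
rewrite /sumdeg [RHS]big_mkcond; apply: eq_bigr => h _.
by rewrite /smooth -msetDA !all_msetD1 e leqnn.
Qed.

(** Let [c g] be the number of distinct primes of maximal degree in [g]. As [c >= 1], the excess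
    [c - 1] is at most [c (c - 1)], the number of ordered pairs of distinct such primes. Both primes
    of a pair have the same degree [d], and removing them leaves a [d]-smooth element of degree
    [n - 2 d]. *)
Lemma sum_top_bounds n : (0 < n)%N ->
  card_deg n <= \sum_(p <- primes_le n) conv (single (deg p)) (sumdeg (smooth (deg p)) (fun=> 1)) n
  /\ \sum_(p <- primes_le n) conv (single (deg p)) (sumdeg (smooth (deg p)) (fun=> 1)) n - card_deg n
   <= \sum_(p <- primes_le n) primes_of setT (deg p)
       * conv (single (2 * deg p)) (sumdeg (smooth (deg p)) (fun=> 1)) n.
Proof.
move=> n0.
pose c g : R := \sum_(p <- primes_le n | top g p) 1.
have cE : \sum_(p <- primes_le n) conv (single (deg p)) (sumdeg (smooth (deg p)) (fun=> 1)) n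
    = \sum_(g <- ofdeg n) c g.
  under eq_bigr => p _ do rewrite -sum_top big_mkcond.
  by rewrite exchange_big; apply: eq_bigr => g _; rewrite /c [RHS]big_mkcond.
have c1 g : g \in ofdeg n -> 1 <= c g.
  rewrite mem_ofdeg => /eqP gn.
  have [|p tp] := @exists_top g; first by rewrite -degG_eq0 gn -lt0n.
  have pn : p \in primes_le n.
    by rewrite mem_primes_le -gn; apply: deg_le_degG; case/andP: tp.
  rewrite /c big_mkcond (bigD1_seq p) ?primes_le_uniq //= tp lerDl sumr_ge0 // => p' _.
  by case: ifP.
rewrite cE (_ : card_deg n = \sum_(g <- ofdeg n) 1) //; split.
  by rewrite big_seq [leRHS]big_seq; apply: ler_sum => g /c1.
rewrite -sumrB.
pose X p p' g : R := if (p != p') && (deg p' == deg p) && (top g p && (p' \in g)) then 1 else 0.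
apply: le_trans (_ : \sum_(g <- ofdeg n) \sum_(p <- primes_le n) \sum_(p' <- primes_le n) X p p' g <= _).
  rewrite big_seq [leRHS]big_seq; apply: ler_sum => g gn.
  apply: le_trans (_ : c g * (c g - 1) <= _).
    by rewrite ler_peMl ?subr_ge0 ?c1.
  rewrite {1}/c mulr_suml big_mkcond big_seq [leRHS]big_seq; apply: ler_sum => p; rewrite mem_primes_le => pn.
  case: ifP => tp; last by rewrite sumr_ge0 // => p' _; rewrite /X; case: ifP.
  have -> : 1 * (c g - 1) = \sum_(p' <- primes_le n | p' != p) (if top g p' then 1 else 0).
    by rewrite mul1r /c big_mkcond (bigD1_seq p) ?primes_le_uniq ?mem_primes_le //= tp addrAC subrr add0r.
  rewrite big_mkcond.
  apply: ler_sum => p' _; case: ifP => [pp|_]; last by rewrite /X; case: ifP.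
  case: ifP => [tp'|_]; last by rewrite /X; case: ifP.
  rewrite /X eq_sym pp tp /=.
  case/andP: tp => pg /mset_allP sp; case/andP: tp' => pg' /mset_allP sp'.
  by rewrite pg' eqn_leq (sp _ pg') (sp' _ pg).
rewrite exchange_big big_seq [leRHS]big_seq; apply: ler_sum => p; rewrite mem_primes_le => pn.
rewrite exchange_big /=.
have -> : primes_of setT (deg p) = \sum_(p' <- primes_le n) (if deg p' == deg p then 1 else 0).
  rewrite /primes_of big_mkcond (@sum_primes_le_widen _ (deg p) n) //.
    by apply: eq_bigr => p' _; rewrite asboolT.
  by move=> p' /gtn_eqF ->; rewrite andbF.
set Y := conv _ _ n.
have Y0 : 0 <= Y by rewrite /Y conv_single; case: ifP => // _; apply: sumr_ge0.
rewrite mulr_suml; apply: ler_sum => p' _; rewrite /X.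
case: (eqVneq p p') => [_|pp] /=; first by rewrite big1 // mulr_ge0 //; case: ifP.
case: eqP => [e|_]; last by rewrite big1 // mul0r.
by rewrite mul1r -big_mkcond sum_top2.
Qed.

(** * Unique primes of minimal degree *)

Definition uPmin g p := (p \in g) && all (fun x => (x == p) || (deg p < deg x)%N) (g : seq P).


Lemma uPminP g p : reflect (p \in g /\ forall x, x \in g -> x != p -> (deg p < deg x)%N) (uPmin g p).
Proof.
apply: (iffP andP) => -[pg h]; split => //.
  by move=> x xg xp; move/mset_allP: h => /(_ x xg); rewrite (negbTE xp).
by apply/mset_allP => x xg; case: eqVneq => //= xp; apply: h.
Qed.

Lemma uPmin_uniq g p p' : uPmin g p -> uPmin g p' -> p = p'.
Proof.
move=> /uPminP[pg h] /uPminP[pg' h']; apply/eqP; case: eqVneq => // pp.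
have := h _ pg'; rewrite eq_sym => /(_ pp) a; have := h' _ pg pp.
by rewrite ltnNge (ltnW a).
Qed.

Lemma pdvdE p g : pdvd p g <-> p \in g.
Proof.
split => [[r ->]|/mset1_subK[r ->]]; last by exists r.
by rewrite in_msetD in_mset1 eqxx.
Qed.

Lemma is_PminE g p : is_Pmin deg g p <-> p \in g /\ forall x, x \in g -> (deg p <= deg x)%N.
Proof.
split=> -[pg h]; split; first exact/pdvdE.
- by move=> x /pdvdE; apply: h.
- exact/pdvdE.
- by move=> x /pdvdE; apply: h.
Qed.

(** [is_Pmin] allows ties, and its uniqueness is what makes the inequality against the other primes
    strict. The multiplicity of the minimal prime in [g] stays unrestricted. *)
Lemma DsetP (S : set P) g : Dset deg S g <-> g = mset0 \/ exists2 p, S p & uPmin g p.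
Proof.
split=> [[->|[[g0 [p0 [hp0 up0]]] [p [hp Sp]]]]|[->|[p Sp /uPminP[pg h]]]]; [by left| |by left|].
  right; exists p => //; have e := up0 _ hp; subst p0.
  have [pg pm] := (is_PminE _ _).1 hp; apply/uPminP; split=> // x xg xp.
  rewrite ltn_neqAle pm // andbT; apply: contra xp => /eqP e.
  by apply/eqP/esym/up0/is_PminE; split=> // y yg; rewrite -e; apply: pm.
have hp : is_Pmin deg g p.
  by apply/is_PminE; split=> // x xg; case: (eqVneq x p) => [->//|/(h _ xg)/ltnW].
right; split; last by exists p.
split; first by move=> g0; move: pg; rewrite g0 in_mset0.
exists p; split=> // x /is_PminE[xg xm]; case: (eqVneq p x) => // px.
by have := h _ xg; rewrite eq_sym => /(_ px); rewrite ltnNge xm.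
Qed.

(** Only squarefree [g] count: [g = p + h] with [p] outside [h], so all primes of [h] have degree
    above [deg p]. The sign is [mu(p)]. *)
Lemma sum_uPmin p n :
  \sum_(g <- ofdeg n | uPmin g p) mu g
  = - conv (single (deg p)) (sumdeg (rough (deg p)) mu) n.
Proof.
rewrite conv_single /uPmin big_mkcondr sum_shift1; case: ifP => _; last by rewrite oppr0.
rewrite /sumdeg -sumrN [RHS]big_mkcond; apply: eq_bigr => h _.
rewrite all_msetD1 eqxx /= mobiusD1; have [ph|ph] := boolP (p \in h).
  by rewrite if_same ifF //; apply/negP => /mset_allP/(_ p ph); rewrite ltnn.
congr (if _ then _ else _); apply: eq_in_all => x xh /=.
by case: eqP => // e; move: ph; rewrite -e xh.
Qed.

Lemma sum_uPmin_exists (Q : pred P) g N : (forall p, uPmin g p -> Q p -> (deg p <= N)%N) ->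
  \sum_(p <- primes_le N | Q p) (if uPmin g p then 1 else 0 : R)
  = if `[< exists2 p, Q p & uPmin g p >] then 1 else 0.
Proof.
move=> hN; rewrite big_mkcond /=; case: asboolP => [[p Qp up]|h].
  rewrite (bigD1_seq p) ?primes_le_uniq ?mem_primes_le ?hN //= Qp up big1 ?addr0 // => x xp.
  case: ifP => // _; case: ifP => // ux; case/eqP: xp; exact: uPmin_uniq ux up.
by rewrite big1 // => p _; case: ifP => // Qp; case: ifP => // up; case: h; exists p.
Qed.

(** The unique minimal prime of [h + k] is [p0] if all primes of [h] have larger degree or if [p0]
    is also the unique minimal prime of [h]; otherwise it must be a prime of [h] of degree below
    [deg p0], and then it is tested against [S]. The cases exclude each other, so indicators add. *)
Lemma Dset_shift (S : set P) k p0 h N : uPmin k p0 -> S p0 -> (deg p0 <= N)%N ->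
  (if `[< Dset deg S (msetD h k) >] then 1 else 0 : R)
  = (if rough (deg p0) h then 1 else 0) + (if uPmin h p0 then 1 else 0)
    + \sum_(p <- primes_le N | `[< S p >] && (deg p < deg p0)%N) (if uPmin h p then 1 else 0).
Proof.
move=> /uPminP[pk mk] Sp0 p0N.
rewrite (@sum_uPmin_exists (fun p => `[< S p >] && (deg p < deg p0)%N)); last first.
  by move=> p _ /andP[_ pp]; apply: leq_trans (ltnW pp) p0N.
have in_hk x : (x \in msetD h k) = (x \in h) || (x \in k) by rewrite in_msetD.
have [rh|nrh] := boolP (rough (deg p0) h).
  move/mset_allP: rh => rh.
  have -> : uPmin h p0 = false.
    by apply/negP => /uPminP[/rh]; rewrite ltnn.
  rewrite [X in _ + X]ifF ?addr0; last first.
    apply/negP => /asboolP[p /andP[_ pp] /uPminP[/rh ph]].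
    by move: pp; rewrite ltnNge (ltnW ph).
  rewrite ifT //; apply/asboolP/DsetP; right; exists p0 => //; apply/uPminP.
  by split=> [|x]; rewrite in_hk ?pk ?orbT // => /orP[/rh|/mk h1 /h1].
rewrite add0r; have [uh|nuh] := boolP (uPmin h p0).
  move/uPminP: (uh) => [ph mh].
  rewrite [X in _ + X]ifF ?addr0; last first.
    apply/negP => /asboolP[p /andP[_ pp] up].
    by move: pp; rewrite (uPmin_uniq up uh) ltnn.
  rewrite ifT //; apply/asboolP/DsetP; right; exists p0 => //; apply/uPminP.
  by split=> [|x]; rewrite in_hk ?pk ?orbT // => /orP[/mh|/mk].
rewrite add0r; congr (if _ then _ else _); apply: asbool_equiv_eq.
split=> [/DsetP[/eqP/mset0P/(_ p0)|[p Sp /uPminP[phk mp]]]|[p /andP[/asboolP Sp pp] /uPminP[ph mh]]].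
- by rewrite in_hk pk orbT.
- have [e|pp0] := eqVneq p p0.
    subst p; case/negP: nuh; apply/uPminP; split=> [|x xh xp]; last by apply: mp; rewrite // in_hk xh.
    case/allPn: nrh => x xh; rewrite -leqNgt => xm.
    have [<-//|xp] := eqVneq x p0.
    by have := mp x; rewrite in_hk xh => /(_ isT xp); rewrite ltnNge xm.
  have pp : (deg p < deg p0)%N by apply: mp; rewrite 1?eq_sym // in_hk pk orbT.
  exists p; first by rewrite pp andbT; apply/asboolP.
  apply/uPminP; split=> [|x xh xp]; last by apply: mp; rewrite // in_hk xh.
  move: phk; rewrite in_hk => /orP[//|/mk /(_ pp0)].
  by rewrite ltnNge (ltnW pp).
apply/DsetP; right; exists p => //; apply/uPminP; split=> [|x]; rewrite in_hk ?ph //.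
move=> /orP[/mh//|xk _]; apply: leq_trans pp _.
by have [->//|xp] := eqVneq x p0; apply/ltnW/mk.
Qed.

(** Weighting the three cases of [Dset_shift] by [mu] leaves Moebius sums over rough elements only,
    so the terms of [mu * a] at a fixed [r = k] reduce to the same sums as the main term. *)
Lemma sum_Dset_shift (S : set P) k p0 N n : uPmin k p0 -> S p0 -> (deg p0 <= N)%N ->
  \sum_(h <- ofdeg n | `[< Dset deg S (msetD h k) >]) mu h
  = sumdeg (rough (deg p0)) mu n - conv (single (deg p0)) (sumdeg (rough (deg p0)) mu) n
    - \sum_(p <- primes_le N | `[< S p >] && (deg p < deg p0)%N)
        conv (single (deg p)) (sumdeg (rough (deg p)) mu) n.
Proof.
move=> uk Sp0 p0N; rewrite -sum_uPmin -sumrN.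
transitivity (sumdeg (rough (deg p0)) mu n + \sum_(g <- ofdeg n | uPmin g p0) mu g +
   \sum_(p <- primes_le N | `[< S p >] && (deg p < deg p0)%N) \sum_(g <- ofdeg n)
      (if uPmin g p then mu g else 0)); last first.
  by congr (_ + _); apply: eq_bigr => p _; rewrite -sum_uPmin [RHS]big_mkcond.
rewrite exchange_big /= /sumdeg.
rewrite [\sum_(g <- _ | rough _ g) _]big_mkcond [\sum_(g <- _ | uPmin g p0) _]big_mkcond -!big_split.
rewrite big_mkcond; apply: eq_bigr => h _ /=.
transitivity (mu h * (if `[< Dset deg S (msetD h k) >] then 1 else 0)).
  by case: ifP; rewrite ?mulr1 ?mulr0.
rewrite (Dset_shift h uk Sp0 p0N) !mulrDr mulr_sumr; congr (_ + _ + _).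
- by case: ifP; rewrite ?mulr1 ?mulr0.
- by case: ifP; rewrite ?mulr1 ?mulr0.
- by apply: eq_bigr => p _; case: ifP; rewrite ?mulr1 ?mulr0.
Qed.

Lemma sum_Dset (S : set P) N n : (0 < n)%N -> (n <= N)%N ->
  \sum_(g <- ofdeg n | `[< Dset deg S g >]) mu g
  = - \sum_(p <- primes_le N | `[< S p >]) conv (single (deg p)) (sumdeg (rough (deg p)) mu) n.
Proof.
move=> n0 nN; rewrite -sumrN.
under [in RHS]eq_bigr => p _ do rewrite -sum_uPmin big_mkcond.
rewrite exchange_big /= big_mkcond big_seq [RHS]big_seq; apply: eq_bigr => g.
rewrite mem_ofdeg => /eqP gn.
transitivity (mu g * (if `[< exists2 p, `[< S p >] & uPmin g p >] then 1 else 0)).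
  have -> : `[< Dset deg S g >] = `[< exists2 p, `[< S p >] & uPmin g p >].
    apply: asbool_equiv_eq; split=> [/DsetP[g0|[p Sp up]]|[p /asboolP Sp up]].
    - by move: n0; rewrite -gn g0 degG0.
    - by exists p => //; apply/asboolP.
    - by apply/DsetP; right; exists p.
  by case: ifP; rewrite ?mulr1 ?mulr0.
rewrite -(@sum_uPmin_exists (fun p => `[< S p >]) g N) ?mulr_sumr.
  by apply: eq_bigr => p _; case: ifP; rewrite ?mulr1 ?mulr0.
by move=> p /uPminP[/deg_le_degG pg _] _; rewrite (leq_trans pg) ?gn.
Qed.

End Combinatorics.

(** * The inverse zeta series under Axiom A *)

Section RealSequences.
Variable R : realType.
Implicit Types a b : nat -> R.
Local Notation NR := (normr_absv R).
Local Notation l1 := (l1bd (@Num.norm R R)).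
Local Notation tendsR := (tends (@Num.norm R R)).
Local Notation toC a := (fun n => ((a n)%:C)%C : R[i]).

Lemma conv_toC a b : conv (toC a) (toC b) = toC (conv a b).
Proof.
apply/funext => n; rewrite /conv rmorph_sum; apply: eq_bigr => i _ /=.
by rewrite rmorphM.
Qed.

Lemma delta0_toC : toC (delta0 R) = delta0 _.
Proof. by apply/funext => n; rewrite /delta0 rmorph_nat. Qed.

Lemma der_toC a : der (toC a) = toC (der a).
Proof. by apply/funext => n; rewrite /der rmorphM /= rmorph_nat. Qed.

Lemma oneminus_toC : toC (oneminus (1 : R)) = oneminus 1.
Proof.
apply/funext => -[|[|n]] //=; first by rewrite !mulr1n rmorphN.
by rewrite !mulr0n !oppr0 ?rmorph0.
Qed.

Lemma l1_toC a A : l1 a A -> l1bd normc (toC a) A.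
Proof. by move=> h n; under eq_bigr do rewrite normc_real; apply: h. Qed.

Lemma has_sum_toC a s : has_sum (@Num.norm R R) a s -> has_sum normc (toC a) (s%:C)%C.
Proof.
by move=> h e /h[n0 hn]; exists n0 => n /hn; rewrite -rmorph_sum -rmorphB normc_real.
Qed.

Lemma conv_norm_le a b A B n : l1 a A -> (forall k, `|b k| <= B) -> `|conv a b n| <= A * B.
Proof.
move=> ha hb; apply: le_trans (N_sum NR _ _ _) _.
have B0 : 0 <= B by apply: le_trans (hb 0%N).
apply: le_trans (ler_wpM2r B0 (ha n.+1)); rewrite mulr_suml; apply: ler_sum => i _.
by rewrite normrM ler_wpM2l.
Qed.

Lemma l1_tends0 a A : l1 a A -> tendsR a 0.
Proof.
move=> ha e e0; have [n0 hn] := l1_tail NR ha e0; exists n0 => n nn.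
by apply: le_trans (hn n.+1); rewrite subr0 big_nat_recr //= lerDr sumr_ge0.
Qed.

Lemma finite_sum_tends0 (X : nat -> nat -> R) M : (forall m, tendsR (X m) 0) ->
  tendsR (fun k => \sum_(m < M) `|X m k|) 0.
Proof.
move=> h; elim: M => [|M ih].
  by move=> e e0; exists 0%N => n _; rewrite big_ord0 subr0 normr0 ltW.
have k : tendsR (fun n => `|X M n|) 0.
  by move=> e e0; have [n0 hn] := h M _ e0; exists n0 => n /hn; rewrite !subr0 normr_id.
have := tendsD NR ih k; rewrite addr0; apply: eq_tends => n.
by rewrite big_ord_recr.
Qed.

Lemma sum_tends0 (X : nat -> nat -> R) : (forall m, tendsR (X m) 0) ->
  (forall e, 0 < e -> exists M, forall k, \sum_(M <= m < k.+1) `|X m k| <= e) ->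
  tendsR (fun k => \sum_(m < k.+1) X m k) 0.
Proof.
move=> h ht e e0; have e2 : 0 < e / 2 by lra.
have [M hM] := ht _ e2; have [n0 hn] := finite_sum_tends0 M h e2.
exists (maxn n0 M) => n; rewrite geq_max => /andP[/hn k1 Mn].
rewrite subr0; apply: le_trans (N_sum NR _ _ _) _.
rewrite -(big_mkord xpredT (fun m => `|X m n|)) (big_cat_nat (n:=M)) //=; last by lia.
rewrite (splitr e); apply: lerD; last exact: hM.
move: k1; rewrite subr0 ger0_norm ?sumr_ge0 // => k1.
by rewrite (big_mkord xpredT (fun m => `|X m n|)).
Qed.

Section MainTerm.
(** Stand for the counts, the von Mangoldt sums and the Moebius sums by degree, all scaled by
    [q^-n]; [ro] stands for [q^(eta - 1)]. *)
Variables (zt lam mm : nat -> R) (c K ro : R).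
Hypothesis c_pos : 0 < c.
Hypothesis ro_ge0 : 0 <= ro.
Hypothesis ro_lt1 : ro < 1.
Hypothesis zt_asymp : forall n, `|zt n - c| <= K * ro ^+ n.
Hypothesis zt0 : zt 0%N = 1.
Hypothesis zt_ge0 : forall n, 0 <= zt n.
Hypothesis zt_lam : logder zt lam.
Hypothesis lam_ge0 : forall n, 0 <= lam n.
Hypothesis lam0 : lam 0%N = 0.
Hypothesis mm_zt : conv mm zt = delta0 R.
Hypothesis mm_le : forall n, `|mm n| <= zt n.
Hypothesis zeta_nz : forall h, has_sum (@Num.norm R R) (fun n => (zt n - c) * (-1) ^+ n) h ->
  c / 2 + h != 0.

Let e := conv mm (ones R).
Let f := conv (oneminus 1) zt.

Lemma K_ge0 : 0 <= K.
Proof. by have := zt_asymp 0; rewrite expr0 mulr1; apply: le_trans. Qed.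

Lemma zt_le n : zt n <= c + K.
Proof.
have := zt_asymp n; have := K_ge0; have : ro ^+ n <= 1 by apply: exprn_ile1 => //; apply: ltW.
by rewrite ler_norml => h1 h2 /andP[_ h3]; nra.
Qed.

Lemma zt_sub_l1 : l1 (fun n => zt n - c) (K / (1 - ro)).
Proof.
move=> n; apply: le_trans (ler_wpM2l K_ge0 (sum_expr_le n ro_ge0 ro_lt1)).
by rewrite mulr_sumr; apply: ler_sum => i _; apply: zt_asymp.
Qed.

(* [ps = r * zt] and [zt = c + O(ro^n)] give [c * (partial sums of r) = ps - r * O(ro^n)]. *)
Lemma partial_sums_bounded (r ps : nat -> R) : conv r zt = ps ->
  (forall n, `|r n| <= zt n) -> (forall n, `|ps n| <= zt n) ->
  forall n, `|conv r (ones R) n| <= ((c + K) + K / (1 - ro) * (c + K)) / c.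
Proof.
move=> rz hr hp n; rewrite ler_pdivlMr // -[X in _ * X <= _]gtr0_norm // -normrM.
have -> : conv r (ones R) n * c = ps n - conv (fun k => zt k - c) r n.
  have -> : ps n = conv zt r n by rewrite convC -rz.
  have {1}-> : zt = (fun k => (zt k - c) + c * ones R k).
    by apply/funext => k; rewrite /ones mulr1 subrK.
  by rewrite convDl convZl /= addrAC subrr add0r mulrC convC.
apply: le_trans (ler_normB _ _) _; apply: lerD; first exact: le_trans (hp n) (zt_le n).
apply: conv_norm_le zt_sub_l1 _ => k; exact: le_trans (hr k) (zt_le k).
Qed.

Lemma e_bounded n : `|e n| <= ((c + K) + K / (1 - ro) * (c + K)) / c.
Proof.
apply: (partial_sums_bounded mm_zt mm_le) => k; rewrite /delta0.
by case: eqP => [->|_]; rewrite ?zt0 ?normr1 ?normr0.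
Qed.

Lemma ones_f : conv (ones R) f = zt.
Proof. by rewrite /f convA (convC (ones R)) conv_oneminus_ones conv0d. Qed.

Lemma e_f : conv e f = delta0 R.
Proof. by rewrite /e -convA ones_f mm_zt. Qed.

Lemma zt_e : conv zt e = ones R.
Proof. by rewrite /e convA (convC zt) mm_zt conv0d. Qed.

Lemma f_S n : `|f n.+1| <= 2 * K * ro ^+ n.
Proof.
rewrite /f conv_oneminusS mul1r.
have -> : zt n.+1 - zt n = (zt n.+1 - c) - (zt n - c) by ring.
apply: le_trans (ler_normB _ _) _.
have -> : 2 * K * ro ^+ n = K * ro ^+ n + K * ro ^+ n by ring.
apply: lerD (zt_asymp n); apply: le_trans (zt_asymp n.+1) _.
by rewrite ler_wpM2l ?K_ge0 // exprS ler_piMl ?exprn_ge0 // ltW.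
Qed.

(** By [f_S] the terms are at most [2 K (n + 1) ro^n], and [(n + 1) ro^n] is the Cauchy square of
    the geometric series. *)
Lemma der_f_l1 : l1 (der f) (2 * K * ((1 - ro)^-1 * (1 - ro)^-1)).
Proof.
have l : l1 (twist ro (ones R)) (1 - ro)^-1.
  move=> n; apply: le_trans (sum_expr_le n ro_ge0 ro_lt1); apply: ler_sum => i _.
  by rewrite /twist mul1r ger0_norm // exprn_ge0.
have ll := l1_conv NR l l; rewrite twist_conv in ll.
have K2 : 0 <= 2 * K by rewrite mulr_ge0 ?K_ge0.
case=> [|n].
  by rewrite big_ord0 !mulr_ge0 ?K_ge0 // invr_ge0 subr_ge0 ltW.
apply: le_trans (ler_wpM2l K2 (ll n)).
rewrite big_ord_recl /= {1}/der mul0r normr0 add0r mulr_sumr; apply: ler_sum => i _.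
rewrite /lift /= /bump /= add1n /twist.
have -> : conv (ones R) (ones R) i = i.+1%:R by rewrite conv_ones /ones sumr_const card_ord.
rewrite /der !normrM !normr_nat (ger0_norm (exprn_ge0 i ro_ge0)) mulrCA ler_wpM2l //.
exact: f_S.
Qed.

Lemma f_l1 : l1 f (1 + 2 * K * ((1 - ro)^-1 * (1 - ro)^-1)).
Proof.
have D := der_f_l1.
have D0 : 0 <= 2 * K * ((1 - ro)^-1 * (1 - ro)^-1) by have := D 0%N; rewrite big_ord0.
case=> [|n]; first by rewrite big_ord0 addr_ge0.
rewrite big_ord_recl {1}/f conv_oneminus0 zt0 normr1 lerD2l.
apply: le_trans (D n.+1); rewrite [leRHS]big_ord_recl ler_wpDl //; apply: ler_sum => i _.
by rewrite /der normrM normr_nat ler_peMl // ler1n.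
Qed.

Lemma f_nonzero (w : R[i]) : normc w <= 1 -> ~ has_sum normc (twist w (toC f)) 0.
Proof.
have NA := normc_absv R.
have fA := l1_toC f_l1; have fD := l1_toC der_f_l1; rewrite -der_toC in fD.
have eB n : normc (toC e n) <= ((c + K) + K / (1 - ro) * (c + K)) / c.
  by rewrite normc_real; apply: e_bounded.
have ef : conv (toC e) (toC f) = delta0 _ by rewrite conv_toC e_f delta0_toC.
rewrite le_eqVlt => /orP[/eqP w1|w1]; last exact: nonzero_inside fA eB ef w1.
(* At 1 the partial sums of [f] are [zt] itself, which tends to [c > 0]. *)
have [->|wn1] := eqVneq w 1.
  move=> h; have zc : tendsR zt c.
    have h0 := l1_tends0 zt_sub_l1; rewrite -[c]add0r.
    have := tendsD NR h0 (tends_cst NR c); rewrite add0r; apply: eq_tends => n.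
    by rewrite subrK.
  have h2 : has_sum normc (twist 1 (toC f)) (c%:C)%C.
    have -> : twist 1 (toC f) = toC f by apply/funext => n; rewrite /twist expr1n mulr1.
    apply: has_sum_toC; apply: tends_shiftS; apply: eq_tends zc => n.
    by rewrite -ones_f convC conv_ones.
  have := tends_uniq NA h2 h; rewrite subr0 normc_real gtr0_norm // => c0.
  by move: c_pos; rewrite c0 ltxx.
(* At -1 the factor [1 - w] is 2 and the polar part of [Z] is [c / 2], so [f] sums to [c + 2 H],
   twice the quantity in [zeta_nz]. *)
have [->|wnN1] := eqVneq w (-1).
  move=> h.
  have l : l1 (fun n => (zt n - c) * (-1) ^+ n) (K / (1 - ro)).
    have N1 : `|-1 : R| <= 1 by rewrite normrN1.
    exact: (l1_twist NR zt_sub_l1 N1).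
  have [H hH] := real_l1_has_sum l.
  have h2 : has_sum normc (twist (-1) (toC f)) ((c + (H + H))%:C)%C.
    have -> : twist (-1) (toC f) = toC (twist (-1) f).
      by apply/funext => n; rewrite /twist rmorphM rmorphXn rmorphN1.
    apply: has_sum_toC; apply: tends_shiftS.
    have hS : tendsR (fun n => \sum_(i < n.+1) (zt i - c) * (-1) ^+ i) H.
      by move=> d /hH[n0 hn]; exists n0 => n k; apply: hn; lia.
    have := tendsD NR (tends_cst NR c) (tendsD NR hS hH); apply: eq_tends.
    elim=> [|n ih].
      by rewrite !big_ord_recl !big_ord0 /twist expr0 !mulr1 /f conv_oneminus0; ring.
    rewrite [RHS]big_ord_recr -ih /= big_ord_recr [\sum_(i < n.+1) _]big_ord_recr /=.
    by rewrite /twist /f conv_oneminusS exprS; ring.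
  have := tends_uniq NA h2 h; rewrite subr0 normc_real => /normr0_eq0 h0.
  have /eqP := zeta_nz hH; apply; lra.
apply: (@nonzero_on_circle _ (toC zt) (toC lam) _ _ _ (c + K) _ _ _ _ _ _ _ fA fD) => //.
- by rewrite /logder der_toC zt_lam conv_toC.
- by move=> n; rewrite lecR.
- by rewrite lam0.
- by rewrite zt0.
- by move=> n; rewrite normc_real ger0_norm // zt_le.
- by rewrite -oneminus_toC conv_toC.
- by rewrite sqrf_eq1 negb_or wn1.
Qed.

Lemma e_l1 : exists E, l1 e E.
Proof.
have fA := l1_toC f_l1; have fD := l1_toC der_f_l1; rewrite -der_toC in fD.
have eB n : normc (toC e n) <= ((c + K) + K / (1 - ro) * (c + K)) / c.
  by rewrite normc_real; apply: e_bounded.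
have ef : conv (toC e) (toC f) = delta0 _ by rewrite conv_toC e_f delta0_toC.
have [E hE] := l1_inverse fA fD f_nonzero ef eB; exists E => n.
by apply: le_trans (hE n); apply: ler_sum => i _; rewrite normc_real.
Qed.

(** Coefficients of [w Z'/Z = w F'/F + w/(1 - w)]: the first part is [der f * e], summable against
    bounded, and the second has coefficients at most 1. *)
Lemma lam_bounded : exists B, forall n, lam n <= B.
Proof.
exists (2 * K * ((1 - ro)^-1 * (1 - ro)^-1) * (((c + K) + K / (1 - ro) * (c + K)) / c) + 1) => n.
have lamE : lam = conv (der zt) mm by rewrite zt_lam -convA (convC zt) mm_zt convC conv0d.
have dz : der zt = (fun n => conv (der (ones R)) f n + conv (ones R) (der f) n).
  by rewrite -der_conv ones_f.
have -> : lam = (fun n => conv (der f) e n + conv (der (ones R)) (oneminus 1) n).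
  rewrite lamE dz convDl; apply/funext => k; rewrite addrC; congr (_ + _).
    by rewrite (convC (ones R)) -convA (convC (ones R)).
  rewrite -convA; congr (conv _ _ k).
  by rewrite /f -convA (convC zt) mm_zt convC conv0d.
apply: lerD.
  by apply: le_trans (ler_norm _) _; apply: conv_norm_le der_f_l1 e_bounded.
rewrite convC; case: n => [|n]; first by rewrite conv_oneminus0 /der mul0r ler01.
by rewrite conv_oneminusS /der !mulr1 mul1r -natr1 addrAC subrr add0r.
Qed.

End MainTerm.
End RealSequences.

(** * Rough and smooth elements *)

Section Density.
Variables (R : realType) (P : countType) (deg : P -> nat).
Hypothesis deg_pos : forall p : P, (0 < deg p)%N.
Hypothesis deg_fin : forall x : nat, finite_set [set g : {mset P} | (degG deg g <= x)%N].
Variables (c q eta K : R).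
Hypothesis c_pos : 0 < c.
Hypothesis q_gt1 : 1 < q.
Hypothesis eta_lt1 : eta < 1.
Hypothesis axiomA : forall n : nat,
  `|(Gsharp deg n)%:R - c * q ^+ n| <= K * q `^ (eta * n%:R).
Hypothesis zeta_nz : Zeta_at_minus_inv_q deg c q != 0.

Local Notation NR := (normr_absv R).
Local Notation l1 := (l1bd (@Num.norm R R)).
Local Notation tendsR := (tends (@Num.norm R R)).
Local Notation mu := (@mobius P R).
Local Notation tw a := (twist q^-1 a).
Local Notation zt := (tw (card_deg R deg)).
Local Notation roughs m := (tw (sumdeg deg (rough deg m) mu)).
Local Notation smooths m := (tw (sumdeg deg (smooth deg m) (fun=> 1 : R))).
Local Notation pn S m := (primes_of R deg S m * q^-1 ^+ m).

Lemma Gsharp_card n : (Gsharp deg n)%:R = card_deg R deg n.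
Proof.
rewrite /Gsharp fsbig_finite; last exact: ofdeg_finite.
by rewrite natr_sum.
Qed.

Lemma prime_countE S n : (prime_count deg S n)%:R = primes_of R deg S n.
Proof.
have fS : finite_set [set p : P | S p /\ deg p = n].
  by apply: sub_finite_set (primes_le_finite deg_fin n) => p /= [_ ->].
rewrite /prime_count fsbig_finite // natr_sum /primes_of -[RHS]big_filter.
apply: perm_big; apply: uniq_perm; rewrite ?fset_uniq ?filter_uniq ?primes_le_uniq // => p.
rewrite mem_filter in_fset_set // (mem_primes_le deg_fin).
apply/idP/andP => [/set_mem[Sp ->]|[/andP[/asboolP Sp /eqP dp] _]]; last by apply/mem_set.
by rewrite eqxx leqnn andbT; split=> //; apply/asboolP.
Qed.

Let q_gt0 : 0 < q. Proof. exact: lt_trans q_gt1. Qed.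
Let x_ge0 n : 0 <= q^-1 ^+ n. Proof. by rewrite exprn_ge0 // invr_ge0 ltW. Qed.
Let ro := q `^ eta / q.

Let ro_ge0 : 0 <= ro. Proof. by rewrite divr_ge0 ?powR_ge0 // ltW. Qed.

Let ro_lt1 : ro < 1.
Proof.
rewrite ltr_pdivrMr // mul1r /powR gt_eqF // -[ltRHS]lnK ?posrE // ltr_expR.
by rewrite gtr_pMl ?ln_gt0.
Qed.

Let zt_asymp n : `|zt n - c| <= K * ro ^+ n.
Proof.
have -> : zt n - c = ((Gsharp deg n)%:R - c * q ^+ n) * q^-1 ^+ n.
  by rewrite /twist Gsharp_card mulrBl -mulrA -exprMn divff ?gt_eqF // expr1n mulr1.
rewrite normrM (ger0_norm (x_ge0 n)) /ro exprMn mulrA ler_wpM2r //.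
have -> : (q `^ eta) ^+ n = q `^ (eta * n%:R) by rewrite powRrM powR_mulrn ?powR_ge0.
exact: axiomA.
Qed.

Let zt_ge0 n : 0 <= zt n.
Proof. by rewrite mulr_ge0 // sumr_ge0. Qed.

Let sumdeg_le (Q : pred {mset P}) (F : {mset P} -> R) n :
  (forall g, `|F g| <= 1) -> `|tw (sumdeg deg Q F) n| <= zt n.
Proof.
move=> F1; rewrite /twist normrM (ger0_norm (x_ge0 n)) ler_wpM2r //.
apply: le_trans (N_sum NR _ _ _) _; rewrite /card_deg /sumdeg big_mkcond.
by apply: ler_sum => g _; case: ifP.
Qed.

Let rough_zt m : conv (roughs m) zt = smooths m.
Proof. by rewrite twist_conv mobius_rough. Qed.

Let smooths0 : smooths 0 = delta0 R.
Proof. by rewrite sumdeg_smooth0 // twist_delta0. Qed.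

Let roughs_le m n : `|roughs m n| <= zt n.
Proof. by apply: sumdeg_le; apply: mobius_norm_le1. Qed.

Let smooths_le m n : `|smooths m n| <= zt n.
Proof. by apply: sumdeg_le => g; rewrite normr1. Qed.

Let smooths_ge0 m n : 0 <= smooths m n.
Proof. by rewrite mulr_ge0 // sumr_ge0. Qed.

Let zt0 : zt 0%N = 1.
Proof. by rewrite /twist expr0 mulr1 /card_deg /sumdeg (sum_ofdeg0 deg_pos deg_fin). Qed.

Let lam := tw (mangoldt R deg).

Let zt_lam : logder zt lam.
Proof. by apply: logder_twist; apply: logder_card_deg. Qed.

Let mm_zt : conv (roughs 0) zt = delta0 R.
Proof. by rewrite rough_zt smooths0. Qed.

Let lam_ge0 n : 0 <= lam n.
Proof. by rewrite mulr_ge0 // mangoldt_ge0. Qed.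

Let lam0 : lam 0%N = 0.
Proof. by rewrite /lam /twist mangoldt0 mul0r. Qed.

(** [limn] is a total operator; convergence of the series to [h] is what pins down its value. *)
Let zeta_value h : has_sum (@Num.norm R R) (fun n => (zt n - c) * (-1) ^+ n) h -> c / 2 + h != 0.
Proof.
move=> hh; suff <- : Zeta_at_minus_inv_q deg c q = c / 2 + h by [].
rewrite /Zeta_at_minus_inv_q; congr (_ + _); apply/cvg_lim => //.
apply/cvgrPdist_le => e e0; have [n0 hn] := hh _ e0; exists n0 => // n /= /hn.
rewrite distrC big_mkord; congr (`|_ - _| <= _); apply: eq_bigr => i _.
have -> : (- q^-1) ^+ i = q^-1 ^+ i * (-1) ^+ i by rewrite [LHS]exprNn mulrC.
rewrite /twist -Gsharp_card mulrA; congr (_ * _).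
by rewrite mulrBl -mulrA -exprMn divff ?gt_eqF // expr1n mulr1.
Qed.

Let e := conv (roughs 0) (ones R).
Definition rough_sum m := conv (roughs m) (ones R).

Let e_l1 : exists E, l1 e E.
Proof.
exact: (e_l1 c_pos ro_ge0 ro_lt1 zt_asymp zt0 zt_ge0 zt_lam lam_ge0 lam0 mm_zt (roughs_le 0)
  zeta_value).
Qed.

Let lam_bounded : exists B, forall n, lam n <= B.
Proof. exact: (lam_bounded c_pos ro_ge0 ro_lt1 zt_asymp zt0 zt_ge0 zt_lam mm_zt (roughs_le 0)). Qed.

Lemma primes_of_bound : exists B : R, forall n, n%:R * pn setT n <= B.
Proof.
have [B hB] := lam_bounded; exists B => n; apply: le_trans (hB n).
by rewrite /lam /twist mulrA ler_wpM2r // mangoldt_ge.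
Qed.

Lemma rough_sum_bounded : exists C, forall m n, `|rough_sum m n| <= C.
Proof.
eexists => m n.
exact: (partial_sums_bounded c_pos ro_ge0 ro_lt1 zt_asymp (rough_zt m) (roughs_le m) (smooths_le m)).
Qed.

Let rough_sumE m : rough_sum m = conv (smooths m) e.
Proof. by rewrite -rough_zt -convA (zt_e mm_zt). Qed.

Lemma single_tw d (a : nat -> R) : tw (conv (single R d) a) = (fun n => q^-1 ^+ d * conv (single R d) (tw a) n).
Proof.
apply/funext => n; rewrite /twist !conv_single; case: leqP => dn; last by rewrite mul0r mulr0.
by rewrite mulrCA -exprD subnKC.
Qed.

Lemma single_l1 d : l1 (single R d) 1.
Proof.
move=> n; apply: le_trans (_ : \sum_(i < n) `|single R d i| <= _) => //.
have [dn|nd] := ltnP d n.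
  rewrite (bigD1 (Ordinal dn)) //= /single eqxx normr1 big1 ?addr0 // => i id.
  by case: eqP => [ed|]; rewrite ?normr0 //; case/negP: id; apply/eqP/val_inj.
rewrite big1 ?ler01 // => i _; rewrite /single ltn_eqF ?normr0 //.
by apply: leq_trans (ltn_ord i) nd.
Qed.

(** Summing the recursion gives [B <= A + x B] for the partial sum [B] of [b]. To apply [l1_conv],
    [b] is first cut off at [n], which makes its total mass equal to [B]. *)
Lemma l1_recursion (a b : nat -> R) d (x A : R) : (forall n, 0 <= b n) -> 0 <= x -> x < 1 ->
  l1 a A -> (forall n, b n = a n + x * conv (single R d) b n) -> l1 b (A / (1 - x)).
Proof.
move=> b0 x0 x1 ha hb n.
have bn : l1bd (@Num.norm R R) (fun i => if (i < n)%N then b i else 0) (\sum_(i < n) b i).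
  move=> N; apply: le_trans (_ : \sum_(i < maxn N n) (if (i < n)%N then b i else 0) <= _).
    rewrite -!(big_mkord xpredT (fun i => if (i < n)%N then b i else 0)).
    rewrite -(big_mkord xpredT (fun i => `|if (i < n)%N then b i else 0|)).
    rewrite [leRHS](big_cat_nat (n:=N)) ?leq_maxl //= ler_wpDr ?sumr_ge0 //.
      by move=> i _; case: ifP.
    by apply: ler_sum => i _; case: ifP; rewrite ?normr0 // ger0_norm.
  by rewrite -big_mkcond /= -(big_ord_widen _ b) // leq_maxr.
have := l1_conv NR (single_l1 d) bn n; rewrite mul1r => k.
have S : \sum_(i < n) b i <= A + x * \sum_(i < n) b i.
  apply: le_trans (lerD (ha n) (ler_wpM2l x0 k)).
  rewrite mulr_sumr -big_split; apply: ler_sum => i _ /=; rewrite {1}hb.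
  apply: lerD; first exact: ler_norm.
  rewrite ler_wpM2l // (le_trans (ler_norm _)) // le_eqVlt; apply/orP; left; apply/eqP.
  congr (`|_|); apply: eq_conv => // j ji.
  by rewrite (leq_ltn_trans ji).
rewrite ler_pdivlMr ?subr_gt0 //.
under eq_bigr do rewrite ger0_norm //.
by lra.
Qed.

(** A finite Euler product: adjoining a prime [p] to the list multiplies the bound by
    [1 / (1 - q^-(deg p))]. *)
Lemma smooths_l1 m : exists A, l1 (smooths m) A.
Proof.
suff h s : uniq s -> exists A, l1 (tw (sumdeg deg (supported s) (fun=> 1))) A.
  have [A hA] := h _ (primes_le_uniq deg m); exists A; apply: l1_ext hA => n.
  congr (_ * _); apply: eq_bigl => g; apply: eq_all => p /=.
  by rewrite (mem_primes_le deg_fin).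
elim: s => [_|p s ih /= /andP[ps us]].
  exists 1; apply: l1_ext (l1_delta0 NR) => n; rewrite -(twist_delta0 q^-1).
  congr (_ * _); rewrite -(sumdeg_smooth0 R deg_pos deg_fin); apply: eq_bigl => g.
  by apply: eq_all => p /=; rewrite leqNgt deg_pos.
have [A hA] := ih us; exists (A / (1 - q^-1 ^+ deg p)).
apply: (l1_recursion (d := deg p) _ (x_ge0 _) _ hA) => [n||n].
- by rewrite mulr_ge0 // sumr_ge0.
- by rewrite exprn_ilt1 ?invr_ge0 ?ltW // ?invf_lt1 // -lt0n.
rewrite -[q^-1 ^+ _ * _](congr1 (fun u => u n) (single_tw _ _)) /twist -mulrDl; congr (_ * _).
rewrite (sumdeg_split deg_fin p); congr (_ + _).
  apply: eq_bigl => g; apply/andP/mset_allP => [[/mset_allP h pg] x xg|h].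
    have /= := h x xg; rewrite inE => /orP[/eqP ex|//].
    by move: pg; rewrite -ex xg.
  split; first by apply/mset_allP => x xg /=; rewrite inE; have /= -> := h x xg; rewrite orbT.
  by apply/negP => /h /=; apply/negP.
apply: eq_conv => // i _; apply: eq_bigl => h.
by rewrite /supported all_msetD1 /= inE eqxx.
Qed.

Lemma smooths_tends0 m : tendsR (smooths m) 0.
Proof. by have [A hA] := smooths_l1 m; apply: l1_tends0 hA. Qed.

Lemma rough_sum_tends0 m : tendsR (rough_sum m) 0.
Proof.
have [E hE] := e_l1; rewrite rough_sumE convC.
exact: (conv_tends0 NR hE (smooths_tends0 m)).
Qed.

Let C1 := c + K.
Let zt_le n : zt n <= C1. Proof. exact: (zt_le ro_ge0 ro_lt1 zt_asymp). Qed.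

Lemma shift_tends0 d a : tendsR a 0 -> tendsR (conv (single R d) a) 0.
Proof. exact: (conv_tends0 NR (single_l1 d)). Qed.

Let tops k := \sum_(m < k.+1) pn setT m * conv (single R m) (smooths m) k.

(* [tops k] counts the pairs (element of degree [k], prime of maximal degree in it), scaled by [q^-k]. *)
Let tops_bounds k : (0 < k)%N -> zt k <= tops k /\ tops k - zt k
  <= \sum_(m < k.+1) (pn setT m) ^+ 2 * conv (single R (2 * m)) (smooths m) k.
Proof.
move=> k0; have [h1 h2] := sum_top_bounds R deg_pos deg_fin k0.
have e1 : tops k = q^-1 ^+ k *
    \sum_(p <- primes_le deg k) conv (single R (deg p)) (sumdeg deg (smooth deg (deg p)) (fun=> 1)) k.
  have := @sum_by_degree R _ _ deg_fin setT k (fun d => conv (single R d) (sumdeg deg (smooth deg d) (fun=> 1)) k).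
  under eq_bigl do rewrite asboolT //.
  move=> ->; rewrite mulr_sumr /tops; apply: eq_bigr => m _.
  by rewrite mulrCA -mulrA; congr (_ * _); rewrite [RHS]mulrC -[RHS](congr1 (fun u => u k) (esym (single_tw _ _))).
have e2 : \sum_(m < k.+1) (pn setT m) ^+ 2 * conv (single R (2 * m)) (smooths m) k
   = q^-1 ^+ k * \sum_(p <- primes_le deg k) primes_of R deg setT (deg p)
       * conv (single R (2 * deg p)) (sumdeg deg (smooth deg (deg p)) (fun=> 1)) k.
  have := @sum_by_degree R _ _ deg_fin setT k (fun d =>
    primes_of R deg setT d * conv (single R (2 * d)) (sumdeg deg (smooth deg d) (fun=> 1)) k).
  under eq_bigl do rewrite asboolT //.
  move=> ->; rewrite mulr_sumr; apply: eq_bigr => m _.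
  have := congr1 (fun u => u k) (single_tw (2 * m) (sumdeg deg (smooth deg m) (fun=> 1))).
  rewrite {1}/twist /= => E; rewrite exprMn -exprM mulnC -mulrA -E expr2; ring.
rewrite e2 e1 /twist; split; first by rewrite mulrC ler_wpM2l.
by rewrite [card_deg _ _ _ * _]mulrC -mulrBr ler_wpM2l.
Qed.

(** Two maximal primes of degree [m] carry the weight [pn^2 = O(1/m^2)], which is summable, while
    for fixed [m] the scaled number of [m]-smooth elements of degree [k] tends to 0. *)
Lemma tops_sub_tends0 : tendsR (fun k => tops k - zt k) 0.
Proof.
have [B hB] := primes_of_bound.
have p0 m : 0 <= pn setT m by rewrite mulr_ge0 // primes_of_ge0.
have B0 : 0 <= B by apply: le_trans (hB 0%N); rewrite mul0r.
have sm0 d m k : 0 <= conv (single R d) (smooths m) k by rewrite conv_single; case: ifP.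
have C10 : 0 <= C1 by apply: le_trans (zt_le 0); rewrite zt0.
have smC d m k : conv (single R d) (smooths m) k <= C1.
  rewrite conv_single; case: ifP => // _; apply: le_trans (zt_le (k - d)).
  by apply: le_trans (smooths_le _ _); apply: ler_norm.
pose X m k := (pn setT m) ^+ 2 * conv (single R (2 * m)) (smooths m) k.
have hX : tendsR (fun k => \sum_(m < k.+1) X m k) 0.
  apply: sum_tends0 => [m|d d0].
    have := tendsZ NR ((pn setT m) ^+ 2) (shift_tends0 (2 * m) (smooths_tends0 m)).
    by rewrite mulr0.
  have lW : l1 (fun m => B ^+ 2 * C1 * (m.+1%:R ^+ 2)^-1) (B ^+ 2 * C1 * 2).
    move=> n; have W0 : 0 <= B ^+ 2 * C1 by rewrite mulr_ge0 ?sqr_ge0.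
    apply: le_trans (ler_wpM2l W0 (sum_inv_sq_le R n)); rewrite mulr_sumr; apply: ler_sum => i _.
    by rewrite ger0_norm // mulr_ge0 // invr_ge0 sqr_ge0.
  (* Term [m.+1] is dominated by entry [m] of the majorant, hence the shift. *)
  have [n0 hn] := l1_tail NR lW d0; exists n0.+1 => k.
  apply: le_trans (hn k); rewrite big_add1 /=; apply: ler_sum => m _.
  rewrite /X normrM !ger0_norm ?sqr_ge0 //; last by rewrite mulr_ge0 ?invr_ge0 ?sqr_ge0 // mulr_ge0 ?sqr_ge0.
  rewrite [leRHS]mulrAC; apply: ler_pM; rewrite ?sqr_ge0 //.
  have pB : pn setT m.+1 <= B / m.+1%:R by rewrite ler_pdivlMr ?ltr0Sn // mulrC.
  rewrite -exprVn -exprMn lerXn2r ?nnegrE //; exact: le_trans pB.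
move=> d d0; have [n0 hn] := hX _ d0; exists n0.+1 => k kn.
have k0 : (0 < k)%N by apply: leq_ltn_trans kn.
have [t1 t2] := tops_bounds k0; rewrite subr0 ger0_norm ?subr_ge0 //.
apply: le_trans t2 _; apply: le_trans (hn k (ltnW kn)).
by rewrite subr0; apply: ler_norm.
Qed.

(** * A set of primes with natural density *)

Section WithDensity.
Variables (S : set P) (delta : R).
Hypothesis S_density : has_natural_density deg S delta.

Let stops k := \sum_(m < k.+1) pn S m * conv (single R m) (smooths m) k.

Let primes_of_le m : primes_of R deg S m <= primes_of R deg setT m.
Proof.
rewrite /primes_of [leLHS]big_mkcond [leRHS]big_mkcond; apply: ler_sum => p _.
by rewrite (asboolT (_ : setT p)) //=; case: ifP => [/andP[_ ->]//|_]; case: ifP.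
Qed.

Let dens m := primes_of R deg S m / primes_of R deg setT m - delta.

Let dens_tends0 : tendsR dens 0.
Proof.
move=> d d0; have /cvgrPdist_le/(_ _ d0)[n0 _ hn] := S_density; exists n0 => n /hn.
by rewrite !prime_countE distrC subr0.
Qed.

(** If no prime has degree [m], the quotient in [dens] is 0 by convention, but both counts vanish
    and the identity persists. *)
Let pn_dens m : pn S m - delta * pn setT m = dens m * pn setT m.
Proof.
rewrite !mulrA -mulrBl; congr (_ * _); rewrite /dens mulrBl; congr (_ - _).
have [p0|p0] := eqVneq (primes_of R deg setT m) 0; last by rewrite divfK.
have : primes_of R deg S m <= 0 by rewrite -p0.
by rewrite p0 mulr0 le_eqVlt ltNge primes_of_ge0 orbF => /eqP.
Qed.

(** [stops - delta tops] is the sum of [dens m] against the nonnegative terms of [tops], whose total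
    is bounded. Large [m] are handled by [dens -> 0], each fixed [m] by [smooths_tends0]. *)
Let stops_tends : tendsR (fun k => stops k - delta * zt k) 0.
Proof.
have p0 m : 0 <= pn setT m by rewrite mulr_ge0 // primes_of_ge0.
have sm0 d m k : 0 <= conv (single R d) (smooths m) k by rewrite conv_single; case: ifP.
have h1 : tendsR (fun k => \sum_(m < k.+1) dens m * (pn setT m * conv (single R m) (smooths m) k)) 0.
  apply: (@sum_tends0 _ (fun m k => dens m * (pn setT m * conv (single R m) (smooths m) k))) => [m|d d0].
    have := tendsZ NR (dens m * pn setT m) (shift_tends0 m (smooths_tends0 m)).
    by rewrite mulr0; apply: eq_tends => k; rewrite -!mulrA.
  have [U U0 hU] := tends_bd NR tops_sub_tends0.
  have C10 : 0 <= C1 by apply: le_trans (zt_le 0); rewrite zt0.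
  have topsU k : tops k <= U + C1.
    by rewrite -lerBlDr (le_trans _ (hU k)) // (le_trans _ (ler_norm _)) // lerB.
  have [|n0 hn] := dens_tends0 (e := d / (U + C1)); first by rewrite divr_gt0 //; lra.
  exists n0 => k; apply: le_trans (_ : (d / (U + C1)) * tops k <= _); last first.
    by rewrite -ler_pdivlMl ?divr_gt0 // ?invf_div; [rewrite -mulrA mulVf ?mulr1 ?gt_eqF //|]; lra.
  have t0 : forall m, 0 <= pn setT m * conv (single R m) (smooths m) k by move=> m; rewrite mulr_ge0.
  apply: le_trans (_ : (d / (U + C1)) * \sum_(n0 <= m < k.+1) pn setT m * conv (single R m) (smooths m) k <= _).
    rewrite mulr_sumr !big_nat; apply: ler_sum => m /andP[nm _].
    by rewrite normrM (ger0_norm (t0 m)) ler_wpM2r // -[dens m]subr0 hn.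
  rewrite ler_wpM2l ?divr_ge0 //; [lra|lra|].
  rewrite /tops -(big_mkord xpredT (fun m => pn setT m * conv (single R m) (smooths m) k)).
  have [nk|kn] := leqP n0 k.+1; last by rewrite (big_geq (ltnW kn)) sumr_ge0.
  by rewrite [leRHS](big_cat_nat (n:=n0)) //= lerDr sumr_ge0.
have h2 := tendsZ NR delta tops_sub_tends0.
have := tendsD NR h1 h2; rewrite mulr0 addr0; apply: eq_tends => k.
rewrite /tops /stops mulrBr addrA; congr (_ - _); rewrite mulr_sumr -big_split.
apply: eq_bigr => m _ /=; rewrite (mulrA (dens m)) -pn_dens; ring.
Qed.

Lemma rough_sums_tend_density :
  tendsR (fun n => \sum_(m < n.+1) pn S m * conv (single R m) (rough_sum m) n) delta.
Proof.
have [E hE] := e_l1.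
have h1 := conv_tends0 NR hE stops_tends.
have h2 : tendsR (fun n => delta * ones R n) delta.
  by apply: eq_tends (tends_cst NR delta) => n; rewrite /ones mulr1.
have := tendsD NR h1 h2; rewrite add0r; apply: eq_tends => n.
rewrite convC -(zt_e mm_zt) -/e -(congr1 (fun u => u n) (convZl delta zt e)).
rewrite -(congr1 (fun u => u n) (convDl (fun k => stops k - delta * zt k) (fun k => delta * zt k) e)).
rewrite /conv; under eq_bigr do rewrite subrK.
(* The shift by [m] kills the terms with [m > i], so [m] may run up to [n] for every [i] before the
   sums are exchanged. *)
transitivity (\sum_(i < n.+1) \sum_(m < n.+1) (pn S m * conv (single R m) (smooths m) i) * e (n - i)%N).
  apply: eq_bigr => i _; rewrite /stops mulr_suml.
  rewrite (big_ord_widen n.+1 (fun m => pn S m * conv (single R m) (smooths m) i * e (n - i)%N)) // big_mkcond.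
  apply: eq_bigr => m _; rewrite ltnS; case: leqP => // im.
  by rewrite conv_single leqNgt im mulr0 mul0r.
rewrite exchange_big; apply: eq_bigr => m _ /=.
transitivity (pn S m * conv (conv (single R m) (smooths m)) e n); last first.
  by rewrite -convA -rough_sumE.
rewrite mulr_sumr; apply: eq_bigr => i _.
by rewrite -!mulrA.
Qed.

End WithDensity.
End Density.

(** * Sums over distinguishable elements *)

(** A positive element of [R[i]] is a positive real, which reduces the norm topology of [R[i]] to
    [normc]. *)
Lemma tends_cvg_complex (R : realType) (u : nat -> R[i]) (s : R[i]) :
  tends normc u s -> u @ \oo --> s.
Proof.
move=> h; apply/(@cvgrPdist_le R[i] (R[i])^o) => -[x y]; rewrite ltcE /= => /andP[/eqP y0 x0].
rewrite y0; have [n0 hn] := h x x0; exists n0 => // n /= nn.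
rewrite -opprB normrN; have := hn n nn; rewrite -lecR; exact.
Qed.

Lemma tends_of_cvg (R : realType) (u : nat -> R) (s : R) :
  u @ \oo --> s -> tends (@Num.norm R R) u s.
Proof.
move=> h e e0; have /cvgrPdist_le/(_ _ e0)[n0 _ hn] := h.
by exists n0 => n /hn; rewrite distrC.
Qed.

Lemma tends_bigsum (R : realType) (I : Type) (r : seq I) (Q : pred I) (F : I -> nat -> R) :
  (forall i, Q i -> tends (@Num.norm R R) (F i) 0) ->
  tends (@Num.norm R R) (fun n => \sum_(i <- r | Q i) F i n) 0.
Proof.
move=> h; elim: r => [|i r ih].
  by apply: eq_tends (tends_cst (normr_absv R) 0) => n; rewrite big_nil.
have [Qi|Qi] := boolP (Q i); last first.
  by apply: eq_tends ih => n; rewrite big_cons (negbTE Qi).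
have := tendsD (normr_absv R) (h i Qi) ih; rewrite addr0; apply: eq_tends => n.
by rewrite big_cons Qi.
Qed.

(** The step [1/(x+1) <= ln((x+1)/x)] is [ln(1 + y) <= y] at [y = -1/(x+1)]. *)
Lemma harmonic_le_ln (R : realType) n : (0 < n)%N ->
  \sum_(i < n) (i.+1%:R : R)^-1 <= 1 + ln (n%:R : R).
Proof.
case: n => // n _; elim: n => [|n ih]; first by rewrite big_ord1 invr1 ln1 addr0.
rewrite big_ord_recr /=; apply: le_trans (lerD ih (lexx _)) _.
rewrite -addrA lerD2l; set x : R := n.+1%:R; have x0 : 0 < x by rewrite ltr0Sn.
have -> : n.+2%:R = x + 1 :> R by rewrite /x -natr1.
have y0 : 0 < x + 1 by lra.
have : ln (1 + - (x + 1)^-1) <= - (x + 1)^-1.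
  by apply: le_ln1Dx; rewrite ltrN2 invf_lt1 //; lra.
have -> : 1 + - (x + 1)^-1 = x / (x + 1) by field; lra.
by rewrite ln_div ?posrE //; lra.
Qed.

Lemma triangular_sum (V : nmodType) (F : nat -> nat -> V) n :
  \sum_(k < n.+1) \sum_(i < k.+1) F i (k - i)%N = \sum_(j < n.+1) \sum_(i < (n - j).+1) F i j.
Proof.
elim: n => [|n ih]; first by rewrite !big_ord1.
rewrite big_ord_recr ih [RHS]big_ord_recr /= subnn big_ord1.
have -> : \sum_(j < n.+1) \sum_(i < (n.+1 - j).+1) F i j
   = \sum_(j < n.+1) (\sum_(i < (n - j).+1) F i j + F (n.+1 - j)%N j).
  by apply: eq_bigr => j _; rewrite subSn -1?ltnS // big_ord_recr.
rewrite big_split -addrA /=; congr (_ + _).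
rewrite (reindex_inj rev_ord_inj) big_ord_recr /=; congr (_ + _).
  apply: eq_bigr => j _ /=; rewrite subSS subKn //.
  by apply: leq_trans (ltnW (ltn_ord j)) _.
by rewrite !subSS subnn subn0.
Qed.

Section Final.
Variables (R : realType) (P : countType) (deg : P -> nat).
Hypothesis deg_pos : forall p : P, (0 < deg p)%N.
Hypothesis deg_fin : forall x : nat, finite_set [set g : {mset P} | (degG deg g <= x)%N].

Lemma fsum_by_degree (V : nmodType) (A : set {mset P}) n (F : {mset P} -> V) :
  (forall g, A g -> (degG deg g <= n)%N) ->
  \sum_(g \in A) F g = \sum_(k < n.+1) \sum_(g <- ofdeg deg k | `[< A g >]) F g.
Proof.
move=> An; have fA : finite_set A by apply: sub_finite_set (deg_fin n).
rewrite fsbig_finite //.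
transitivity (\sum_(g <- fset_set A) \sum_(k < n.+1) (if degG deg g == k then F g else 0)).
  rewrite big_seq [RHS]big_seq; apply: eq_bigr => g; rewrite in_fset_set // => /set_mem Ag.
  rewrite (bigD1 (Ordinal (An g Ag : (degG deg g < n.+1)%N))) //= eqxx big1 ?addr0 // => i ig.
  by case: eqP => // e; case/negP: ig; apply/eqP/val_inj.
rewrite exchange_big; apply: eq_bigr => k _; rewrite -big_mkcond -[LHS]big_filter -[RHS]big_filter.
apply: perm_big; apply: uniq_perm; rewrite ?filter_uniq ?ofdeg_uniq ?fset_uniq // => g.
rewrite !mem_filter in_fset_set // (mem_ofdeg deg_fin) andbC; congr (_ && _).
Qed.


Variables (c q eta K : R).
Hypothesis c_pos : 0 < c.
Hypothesis q_gt1 : 1 < q.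
Hypothesis eta_lt1 : eta < 1.
Hypothesis axiomA : forall n : nat,
  `|(Gsharp deg n)%:R - c * q ^+ n| <= K * q `^ (eta * n%:R).
Hypothesis zeta_nz : Zeta_at_minus_inv_q deg c q != 0.
Variables (S : set P) (delta : R).
Hypothesis S_density : has_natural_density deg S delta.

Local Notation NR := (normr_absv R).
Local Notation NA := (normc_absv R).
Local Notation tendsR := (tends (@Num.norm R R)).
Local Notation mu := (@mobius P R).
Local Notation tw a := (twist q^-1 a).
Local Notation roughs m := (tw (sumdeg deg (rough deg m) mu)).
Local Notation V := (rough_sum deg q).
Local Notation pn T m := (primes_of R deg T m * q^-1 ^+ m).

Let q_gt0 : 0 < q. Proof. exact: lt_trans q_gt1. Qed.
Let x_ge0 n : 0 <= q^-1 ^+ n. Proof. by rewrite exprn_ge0 // invr_ge0 ltW. Qed.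

Let sum_tw_single d n :
  \sum_(k < n.+1) tw (conv (single R d) (sumdeg deg (rough deg d) mu)) k
  = q^-1 ^+ d * conv (single R d) (V d) n.
Proof.
rewrite single_tw // -mulr_sumr; congr (_ * _).
by rewrite /rough_sum convA conv_ones.
Qed.

Let mainsum n := \sum_(k < n.+1 | (0 < k)%N) q^-1 ^+ k *
  \sum_(g <- ofdeg deg k | `[< Dset deg S g >]) mu g.

Let mainsumE n : mainsum n = - \sum_(m < n.+1) pn S m * conv (single R m) (V m) n.
Proof.
pose Y k := \sum_(m < n.+1) primes_of R deg S m * tw (conv (single R m) (sumdeg deg (rough deg m) mu)) k.
have Y0 : Y 0%N = 0.
  rewrite /Y big1 // => -[[|m] mn] _ /=; rewrite /twist conv_single ?mul0r ?mulr0 //.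
  rewrite /primes_of big1 ?mul0r // => p /andP[_ /eqP d0].
  by have := deg_pos p; rewrite d0.
transitivity (- \sum_(k < n.+1) Y k).
  rewrite /mainsum big_mkcond /= -sumrN; apply: eq_bigr => k _; case: ifP => [k0|]; last first.
    by case: (nat_of_ord k) => // _; rewrite Y0 oppr0.
  rewrite (sum_Dset R deg_fin S k0 (ltn_ord k : (k <= n)%N)).
  rewrite (sum_by_degree deg_fin S n (fun d => conv (single R d) (sumdeg deg (rough deg d) mu) k)).
  rewrite mulrN mulr_sumr; congr (- _); apply: eq_bigr => m _.
  by rewrite /twist mulrCA; congr (_ * _); rewrite mulrC.
rewrite exchange_big; congr (- _); apply: eq_bigr => m _ /=.
by rewrite -mulr_sumr sum_tw_single mulrA.
Qed.

Let mainsum_tends : tendsR mainsum (- delta).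
Proof.
have h := rough_sums_tend_density deg_pos deg_fin c_pos q_gt1 eta_lt1 axiomA zeta_nz S_density.
have := tendsZ NR (-1) h; rewrite mulN1r; apply: eq_tends => n.
by rewrite mulN1r mainsumE.
Qed.

Let mainsum_toC_tends : tends normc (fun n => (-1) * ((mainsum n)%:C)%C) ((delta%:C)%C).
Proof.
have -> : (delta%:C)%C = (-1) * ((- delta)%:C)%C by rewrite rmorphN mulN1r /= opprK.
by apply: (tendsZ NA) => d /mainsum_tends[n0 hn]; exists n0 => n /hn; rewrite -rmorphB normc_real.
Qed.

(** The factor with which [a(r) / ||r||] enters the main sum, before [n] is lowered by [deg r]. *)
Let shifted (r : {mset P}) n := \sum_(i < n.+1) q^-1 ^+ i *
  \sum_(h <- ofdeg deg i | `[< Dset deg S (msetD h r) >]) mu h.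

Let shiftedE r p n : uPmin deg r p -> S p -> shifted r n
  = V (deg p) n - q^-1 ^+ deg p * conv (single R (deg p)) (V (deg p)) n
   - \sum_(p' <- primes_le deg (deg p) | `[< S p' >] && (deg p' < deg p)%N)
       q^-1 ^+ deg p' * conv (single R (deg p')) (V (deg p')) n.
Proof.
move=> up Sp; rewrite /shifted.
transitivity (\sum_(i < n.+1) (roughs (deg p) i
    - tw (conv (single R (deg p)) (sumdeg deg (rough deg (deg p)) mu)) i
    - \sum_(p' <- primes_le deg (deg p) | `[< S p' >] && (deg p' < deg p)%N)
        tw (conv (single R (deg p')) (sumdeg deg (rough deg (deg p')) mu)) i)).
  apply: eq_bigr => i _; rewrite (sum_Dset_shift R deg_fin i up Sp (leqnn _)) !mulrBr.
  congr (_ - _ - _); [by rewrite mulrC|by rewrite mulrC|rewrite mulr_sumr].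
  by apply: eq_bigr => p' _; rewrite mulrC.
rewrite !sumrB; congr (_ - _ - _).
- by rewrite /rough_sum conv_ones.
- by rewrite -sum_tw_single.
- by rewrite exchange_big /=; apply: eq_bigr => p' _; rewrite -sum_tw_single.
Qed.

Let V_tends0 := rough_sum_tends0 deg_pos deg_fin c_pos q_gt1 eta_lt1 axiomA zeta_nz.

Let shifted_tends0 r : Dset deg S r -> r != mset0 -> tendsR (shifted r) 0.
Proof.
move=> /DsetP[->|[p Sp up] _]; first by rewrite eqxx.
have h1 : tendsR (V (deg p)) 0 by apply: V_tends0.
have h2 d : tendsR (fun n => q^-1 ^+ d * conv (single R d) (V d) n) 0.
  have := tendsZ NR (q^-1 ^+ d) (@shift_tends0 R d _ (V_tends0 d)).
  by rewrite mulr0.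
have h3 : tendsR (fun n => \sum_(p' <- primes_le deg (deg p) | `[< S p' >] && (deg p' < deg p)%N)
       q^-1 ^+ deg p' * conv (single R (deg p')) (V (deg p')) n) 0.
  by apply: tends_bigsum => p' _; apply: h2.
have k := tendsD NR (tendsD NR h1 (tendsZ NR (-1) (h2 (deg p)))) (tendsZ NR (-1) h3).
rewrite !mulr0 !addr0 in k; apply: eq_tends k => n.
by rewrite (shiftedE n up Sp) !mulN1r.
Qed.

(** By [shiftedE] there are two bounded terms and one for each [p'] in [S] of degree below [deg p],
    of size [O(q^-(deg p'))]. Chebyshev's bound turns these weights into a harmonic sum of length
    [deg p <= deg r], hence the logarithm. *)
Let shifted_bound : exists D, forall r n, Dset deg S r -> r != mset0 ->
  `|shifted r n| <= D * (1 + ln (degG deg r)%:R).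
Proof.
have [C hC] := rough_sum_bounded deg_pos deg_fin c_pos q_gt1 eta_lt1 axiomA.
have [B hB] := primes_of_bound deg_pos deg_fin c_pos q_gt1 eta_lt1 axiomA.
have C0 : 0 <= C by apply: le_trans (hC 0%N 0%N).
have B0 : 0 <= B by apply: le_trans (hB 0%N); rewrite mul0r.
have x1 d : q^-1 ^+ d <= 1.
  by rewrite exprn_ile1 ?invr_ge0 ?invf_le1 // ltW.
have sC d n : `|conv (single R d) (V d) n| <= C.
  by rewrite conv_single; case: ifP => _; rewrite ?hC // normr0.
exists (C * 2 + C * B) => r n /DsetP[->|[p Sp up] r0]; first by rewrite eqxx.
rewrite (shiftedE n up Sp).
have h1 : `|q^-1 ^+ deg p * conv (single R (deg p)) (V (deg p)) n| <= C.
  by rewrite normrM (ger0_norm (x_ge0 _)) -[leRHS]mul1r ler_pM.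
set T := \sum_(p' <- _ | _) _.
have pr : p \in r by case/uPminP: up.
have r1 : (0 < degG deg r)%N := leq_trans (deg_pos p) (deg_le_degG deg pr).
have hT : `|T| <= C * B * (1 + ln (degG deg r)%:R).
  apply: le_trans (N_sum NR _ _ _) _; rewrite /=.
  apply: le_trans (_ : \sum_(p' <- primes_le deg (deg p) | `[< setT p' >]) C * q^-1 ^+ deg p' <= _).
    rewrite [leLHS]big_mkcond [leRHS]big_mkcond; apply: ler_sum => p' _.
    rewrite (asboolT (_ : setT p')) //; case: ifP => _; last by rewrite mulr_ge0.
    by rewrite normrM (ger0_norm (x_ge0 _)) mulrC ler_wpM2r.
  rewrite (sum_by_degree deg_fin setT (deg p) (fun d => C * q^-1 ^+ d)).
  rewrite -mulrA; apply: le_trans (_ : C * \sum_(i < deg p) B * i.+1%:R^-1 <= _).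
    rewrite big_ord_recl /= {1}/primes_of big1 ?mul0r ?add0r; last first.
      by move=> p' /andP[_ /eqP d0]; have := deg_pos p'; rewrite d0.
    rewrite mulr_sumr; apply: ler_sum => i _; rewrite mulrCA ler_wpM2l //.
    by rewrite /lift /= /bump /= add1n ler_pdivlMr ?ltr0Sn // mulrC hB.
  rewrite ler_wpM2l // -mulr_sumr ler_wpM2l //.
  apply: le_trans (_ : \sum_(i < degG deg r) (i.+1%:R)^-1 <= _); last exact: harmonic_le_ln.
  rewrite -!(big_mkord xpredT (fun i => (i.+1%:R : R)^-1)).
  rewrite [leRHS](big_cat_nat (n := deg p)) //=; last exact: deg_le_degG.
  by rewrite lerDl sumr_ge0.
have l0 : 0 <= ln ((degG deg r)%:R : R) by apply: ln_ge0; rewrite ler1n.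
apply: le_trans (ler_normB _ _) _; apply: le_trans (lerD (ler_normB _ _) (lexx _)) _.
apply: le_trans (lerD (lerD (hC _ _) h1) hT) _.
rewrite [leRHS]mulrDl; apply: lerD => //.
have : 0 <= C * ln (degG deg r)%:R by rewrite mulr_ge0.
by lra.
Qed.

(** * Convolution with a general [a] *)

Section Convolution.
Variable a : {mset P} -> R[i].
Hypothesis a_supp : forall g, ~ Dset deg S g -> a g = 0.
Hypothesis a0 : a mset0 = 1.
Hypothesis a_summable : exists l : R,
  (fun n => \sum_(g \in Dn deg S n)
     (normc (a g) / normG deg q g * ln (ln (normG deg q g)))) @ \oo --> l.

Local Notation toC x := ((x)%:C)%C.

Let weight j : R := \sum_(r <- ofdeg deg j | `[< Dset deg S r >]) normc (a r) * q^-1 ^+ j.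

Let weight_ge0 j : 0 <= weight j.
Proof. by apply: sumr_ge0 => r _; rewrite mulr_ge0 ?normc_ge0. Qed.

Lemma mobius_toC g : mobius R[i] g = toC (mu g).
Proof. by rewrite /mobius; case: ifP => _; rewrite ?rmorphXn ?rmorphN1 ?rmorph0. Qed.

Lemma sum_Dn (W : nmodType) (F : {mset P} -> W) n :
  \sum_(g \in Dn deg S n) F g
  = \sum_(k < n.+1 | (0 < k)%N) \sum_(g <- ofdeg deg k | `[< Dset deg S g >]) F g.
Proof.
rewrite (@fsum_by_degree _ _ n); last by move=> g [/andP[]].
rewrite [RHS]big_mkcond; apply: eq_bigr => k _; rewrite big_seq_cond.
case: ifP => k0; last first.
  rewrite big1 // => g /andP[]; rewrite (mem_ofdeg deg_fin) => /eqP gk /asboolP[].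
  by rewrite gk k0.
rewrite [RHS]big_seq_cond; apply: eq_bigl => g; rewrite (mem_ofdeg deg_fin).
case: eqP => //= gk; apply: asbool_equiv_eq; rewrite /Dn /= gk k0 -ltnS ltn_ord.
by split => [[]|].
Qed.

(** In degree [j] the double logarithm is [ln j + L] with [L = ln (ln q)], which may be negative. As
    soon as [ln j >= 1 - 2 L], it dominates half of [1 + ln j], so the tails of the assumed series
    control the weight needed here. *)
Let weight_tail (d : R) : 0 < d -> exists M, forall k,
  \sum_(M <= j < k.+1) weight j * (1 + ln j%:R) <= d.
Proof.
move=> d0; have [l hl] := a_summable.
pose A j : R := weight j * ln (ln (q ^+ j)).
have {hl} hA : tendsR (fun n => \sum_(j < n.+1 | (0 < j)%N) A j) l.
  apply: eq_tends (tends_of_cvg hl) => n; rewrite sum_Dn; apply: eq_bigr => j _.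
  rewrite /A /weight mulr_suml big_seq_cond [RHS]big_seq_cond; apply: eq_bigr => r.
  by rewrite (mem_ofdeg deg_fin) /normG exprVn => /andP[/eqP -> _].
have Lq : 0 < ln q by rewrite ln_gt0.
pose L := ln (ln q).
have lnE j : (0 < j)%N -> ln (ln (q ^+ j)) = ln j%:R + L.
  by move=> j0; rewrite lnXn // -[_ *+ j]mulr_natl lnM ?posrE // ltr0n.
pose T := Num.max (1 - 2 * L) (- L).
pose J := Num.Def.archi_bound (expR T).
have hJ j : (J <= j)%N -> T <= ln j%:R.
  move=> Jj; rewrite -[T]expRK ler_ln ?posrE ?expR_gt0 //; last first.
    by apply: lt_le_trans (expR_gt0 T) _; apply: le_trans (ltW (archi_boundP _)) _; rewrite ?ler_nat ?expR_ge0.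
  by apply: le_trans (ltW (archi_boundP (expR_ge0 T))) _; rewrite ler_nat.
(* Two partial sums within [d / 4] of the limit differ by at most [d / 2], and the comparison costs
   a factor 2. *)
have d4 : 0 < d / 4 by lra.
have [n0 hn] := hA _ d4.
exists (maxn J n0).+1 => k; have [kM|Mk] := leqP k (maxn J n0).
  by rewrite big_geq ?ltW.
apply: le_trans (_ : 2 * \sum_((maxn J n0).+1 <= j < k.+1) A j <= _).
  rewrite mulr_sumr !big_nat; apply: ler_sum => j /andP[Mj _].
  have j0 : (0 < j)%N by apply: leq_ltn_trans Mj.
  have Jj : (J <= j)%N by apply: leq_trans (leq_maxl _ _) (ltnW Mj).
  rewrite /A mulrCA ler_wpM2l // lnE //; have := hJ j Jj.
  by rewrite /T ge_max => /andP[]; lra.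
have : \sum_((maxn J n0).+1 <= j < k.+1) A j
   = (\sum_(j < k.+1 | (0 < j)%N) A j - l) - (\sum_(j < (maxn J n0).+1 | (0 < j)%N) A j - l).
  rewrite -!(big_mkord (fun j => 0 < j)%N A) (@big_cat_nat _ _ _ (maxn J n0).+1 0 k.+1) //=;
    last by rewrite ltnS ltnW.
  rewrite [X in _ = (_ + X - _) - _]big_nat_cond [LHS]big_nat.
  rewrite [X in _ = (_ + X - _) - _](eq_bigl (fun i => ((maxn J n0).+1 <= i < k.+1)%N)); last first.
    by move=> i; rewrite andb_idr // => /andP[]; case: i.
  ring.
move=> ->; have := hn k; have := hn (maxn J n0); rewrite leq_maxr (leq_trans (leq_maxr J n0) (ltnW Mk)).
by move=> /(_ isT) + /(_ isT); rewrite !ler_norml => /andP[? ?] /andP[? ?]; lra.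
Qed.

Let rest n : R[i] := \sum_(j < n.+1 | (0 < j)%N)
  \sum_(r <- ofdeg deg j | `[< Dset deg S r >]) a r * toC (q^-1 ^+ j * conv (single R j) (shifted r) n).

(** Dominated convergence over [j = deg r]: each degree has finitely many [r], each with
    [shifted r -> 0], and [shifted_bound] with [weight_tail] bounds the large degrees uniformly in
    [n]. *)
Let rest_tends0 : tends normc rest 0.
Proof.
have [D hD] := shifted_bound.
pose X j n : R := if (0 < j)%N then
  \sum_(r <- ofdeg deg j | `[< Dset deg S r >])
    normc (a r) * q^-1 ^+ j * `|conv (single R j) (shifted r) n| else 0.
have X0 j n : 0 <= X j n.
  rewrite /X; case: ifP => // _; apply: sumr_ge0 => r _.
  by rewrite !mulr_ge0 ?normc_ge0.
have r_neq0 j r : (0 < j)%N -> r \in ofdeg deg j -> r != mset0.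
  by rewrite (mem_ofdeg deg_fin) => j0 /eqP rj; rewrite -(degG_eq0 deg_pos) rj -lt0n.
have h : tendsR (fun n => \sum_(j < n.+1) X j n) 0.
  apply: sum_tends0 => [j|d d0].
    have [j0|j0] := boolP (0 < j)%N; last first.
      by apply: eq_tends (tends_cst NR 0) => n; rewrite /X (negbTE j0).
    have hh : tendsR (fun n => \sum_(r <- ofdeg deg j | (r \in ofdeg deg j) && `[< Dset deg S r >])
        normc (a r) * q^-1 ^+ j * `|conv (single R j) (shifted r) n|) 0.
      apply: tends_bigsum => r /andP[rj /asboolP Dr].
      have t0 := @shift_tends0 R j _ (shifted_tends0 Dr (r_neq0 _ _ j0 rj)).
      have t1 : tendsR (fun n => `|conv (single R j) (shifted r) n|) 0.
        by move=> e /t0[n0 hn]; exists n0 => n /hn; rewrite !subr0 normr_id.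
      by have := tendsZ NR (normc (a r) * q^-1 ^+ j) t1; rewrite mulr0.
    by apply: eq_tends hh => n; rewrite /X j0 -big_seq_cond.
  have D1 : 0 < `|D| + 1 by rewrite ltr_wpDl.
  (* Starting at [M.+1] keeps [j] positive, so that [r] is not the identity and [ln j >= 0]. *)
  have [M hM] := weight_tail (d := d / (`|D| + 1)) (divr_gt0 d0 D1); exists M.+1 => k.
  apply: le_trans (_ : (`|D| + 1) * \sum_(M <= j < k.+1) weight j * (1 + ln j%:R) <= _); last first.
    by rewrite mulrC -ler_pdivlMr.
  rewrite mulr_sumr.
  apply: le_trans (_ : \sum_(M.+1 <= j < k.+1) (`|D| + 1) * (weight j * (1 + ln j%:R)) <= _).
    rewrite big_nat [leRHS]big_nat; apply: ler_sum => j /andP[Mj _].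
    have j0 : (0 < j)%N by apply: leq_ltn_trans Mj.
    rewrite (ger0_norm (X0 _ _)) /X j0 /weight mulr_suml mulr_sumr.
    rewrite big_seq_cond [leRHS]big_seq_cond; apply: ler_sum => r /andP[rj /asboolP Dr].
    rewrite mulrCA ler_wpM2l ?mulr_ge0 ?normc_ge0 //.
    have l0 : 0 <= ln (j%:R : R) by rewrite ln_ge0 // ler1n.
    rewrite conv_single; case: ifP => _; last first.
      by rewrite normr0 mulr_ge0 //; lra.
    apply: le_trans (hD r _ Dr (r_neq0 _ _ j0 rj)) _.
    have -> : degG deg r = j by apply/eqP; rewrite -(mem_ofdeg deg_fin).
    rewrite ler_wpM2r //; first lra.
    by apply: le_trans (ler_norm _) _; lra.
  have [Mk|kM] := leqP M k; last by rewrite !big_geq // ltnW.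
  rewrite [leRHS]big_ltn // lerDr !mulr_ge0 ?(ltW D1) //.
  case: M {hM Mk} => [|M]; first by rewrite ln0 ?addr0.
  by rewrite addr_ge0 // ln_ge0 // ler1n.
move=> d d0; have [n0 hn] := h _ d0; exists n0 => n /hn; rewrite !subr0 => k.
apply: le_trans (_ : \sum_(j < n.+1) X j n <= _); last exact: le_trans (ler_norm _) k.
rewrite /rest; apply: le_trans (N_sum NA _ _ _) _; rewrite big_mkcond; apply: ler_sum => j _.
case: ifP => j0; last exact: X0.
rewrite /X j0; apply: le_trans (N_sum NA _ _ _) _; apply: ler_sum => r _.
by rewrite (absM NA) normc_real normrM (ger0_norm (x_ge0 _)) mulrA.
Qed.

Let mu_convE g : mu_conv a g
  = \sum_(i < (degG deg g).+1) \sum_(h <- ofdeg deg i | msubset h g) toC (mu h) * a (msetB g h).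
Proof.
rewrite /mu_conv (@fsum_by_degree _ _ (degG deg g)); last first.
  by move=> h [r ->]; rewrite degGD leq_addr.
apply: eq_bigr => i _; apply: eq_big => [h|h _]; last by rewrite mobius_toC.
apply/asboolP/idP => [[r ->]|hg]; first by apply/msubsetP => x; rewrite msetE2 leq_addr.
exists (msetB g h); apply/msetP => x; rewrite !msetE2 subnKC //; exact: (msubsetP hg).
Qed.

Let block i j : R[i] := \sum_(r <- ofdeg deg j) a r *
  toC (\sum_(h <- ofdeg deg i | `[< Dset deg S (msetD h r) >]) mu h).

(** Pairs of [g] and a divisor [h] become pairs [(h, r)] with [g = h + r]; grouping by [r] leaves
    the condition that [h + r] lies in the set. *)
Let sum_mu_conv k : \sum_(g <- ofdeg deg k | `[< Dset deg S g >]) mu_conv a g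
  = \sum_(i < k.+1) block i (k - i).
Proof.
transitivity (\sum_(g <- ofdeg deg k | `[< Dset deg S g >]) \sum_(i < k.+1)
    \sum_(h <- ofdeg deg i | msubset h g) toC (mu h) * a (msetB g h)).
  rewrite big_seq_cond [RHS]big_seq_cond; apply: eq_bigr => g /andP[].
  by rewrite (mem_ofdeg deg_fin) => /eqP gk _; rewrite mu_convE gk.
rewrite exchange_big; apply: eq_bigr => i _.
rewrite (exchange_big_dep xpredT) //= /block.
transitivity (\sum_(h <- ofdeg deg i)
    \sum_(r <- ofdeg deg (k - i) | `[< Dset deg S (msetD h r) >]) toC (mu h) * a r).
  rewrite big_seq [RHS]big_seq; apply: eq_bigr => h; rewrite (mem_ofdeg deg_fin) => /eqP hi.
  under eq_bigl => g do rewrite andbC.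
  rewrite big_mkcondr (sum_shift deg_fin) hi -ltnS ltn_ord [RHS]big_mkcond.
  by apply: eq_bigr => r _; rewrite msetDKB.
rewrite (exchange_big_dep xpredT) //=; apply: eq_bigr => r _.
by rewrite rmorph_sum mulr_sumr; apply: eq_bigr => h _; rewrite mulrC.
Qed.

(** Grouped by [j = deg r]: for [j = 0] only the identity occurs and [a0] gives [mainsum]; for
    [j > 0] the support of [a] restricts [r] to the set, where [shifted r] is under control. *)
Let expand n : \sum_(g \in Dn deg S n) (mu_conv a g / toC (normG deg q g))
  = toC (mainsum n) + rest n.
Proof.
pose z : R[i] := toC q^-1.
have zE k : toC (q^-1 ^+ k) = z ^+ k by rewrite rmorphXn.
have -> : \sum_(g \in Dn deg S n) (mu_conv a g / toC (normG deg q g))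
    = \sum_(k < n.+1 | (0 < k)%N) \sum_(i < k.+1) z ^+ k * block i (k - i).
  rewrite sum_Dn; apply: eq_bigr => k _; rewrite -mulr_sumr -sum_mu_conv mulr_sumr.
  rewrite big_seq_cond [RHS]big_seq_cond; apply: eq_bigr => g /andP[].
  rewrite (mem_ofdeg deg_fin) /normG => /eqP -> _.
  by rewrite mulrC -zE exprVn fmorphV.
pose F i j : R[i] := if (0 < i + j)%N then z ^+ (i + j) * block i j else 0.
have -> : \sum_(k < n.+1 | (0 < k)%N) \sum_(i < k.+1) z ^+ k * block i (k - i)
    = \sum_(k < n.+1) \sum_(i < k.+1) F i (k - i)%N.
  rewrite big_mkcond; apply: eq_bigr => k _; case: ifP => k0.
    by apply: eq_bigr => i _; rewrite /F subnKC ?k0 // -ltnS.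
  by rewrite big1 // => i _; rewrite /F subnKC ?k0 // -ltnS.
rewrite triangular_sum big_ord_recl subn0 /=; congr (_ + _).
  rewrite /mainsum [X in toC X]big_mkcond rmorph_sum; apply: eq_bigr => i _.
  rewrite /F addn0 /=; case: ifP => _; last by rewrite rmorph0.
  rewrite /block -[ofdeg deg 0]/(ofdeg deg 0) (sum_ofdeg0 deg_pos deg_fin xpredT) a0 mul1r /=.
  rewrite [in RHS]rmorphM /= zE; congr (_ * toC _); apply: eq_bigl => g.
  by congr (`[< Dset deg S _ >]); rewrite msetD0.
rewrite /rest [RHS]big_mkcond [RHS]big_ord_recl /= add0r; apply: eq_bigr => j _.
rewrite /lift /= /bump /= add1n.
transitivity (\sum_(r <- ofdeg deg j.+1) \sum_(i < (n - j.+1).+1)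
   a r * toC (q^-1 ^+ j.+1 * (q^-1 ^+ i * \sum_(h <- ofdeg deg i | `[< Dset deg S (msetD h r) >]) mu h))).
  rewrite exchange_big; apply: eq_bigr => i _; rewrite /F addnS /= /block mulr_sumr.
  apply: eq_bigr => r _; rewrite mulrCA -zE -rmorphM /=; congr (_ * toC _).
  by rewrite mulrA -exprD; congr (_ ^+ _ * _); lia.
rewrite [RHS]big_mkcond; apply: eq_bigr => r _.
case: asboolP => Dr; last by rewrite a_supp // big1 // => i _; rewrite mul0r.
rewrite -mulr_sumr conv_single -ltnS ltnS ltn_ord -rmorph_sum -mulr_sumr.
by [].
Qed.

Lemma convolution_limit :
  (fun n => - \sum_(g \in Dn deg S n) (mu_conv a g / toC (normG deg q g))) @ \oo --> toC delta.
Proof.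
apply: tends_cvg_complex.
have h2 := tendsD NA mainsum_toC_tends (tendsZ NA (-1) rest_tends0).
rewrite mulr0 addr0 in h2; apply: eq_tends h2 => n.
by rewrite expand -mulrDr mulN1r.
Qed.

End Convolution.

Lemma mobius_limit :
  (fun n => - \sum_(g \in Dn deg S n) (mobius R[i] g / ((normG deg q g)%:C)%C))
    @ \oo --> (delta%:C)%C.
Proof.
apply: tends_cvg_complex; apply: eq_tends mainsum_toC_tends => n; rewrite mulN1r; congr (- _); apply/esym.
rewrite sum_Dn /mainsum rmorph_sum; apply: eq_bigr => j _.
rewrite mulr_sumr rmorph_sum big_seq_cond [RHS]big_seq_cond; apply: eq_bigr => g /andP[].
rewrite (mem_ofdeg deg_fin) /normG => /eqP -> _.
by rewrite mobius_toC -fmorphV -rmorphM /= mulrC exprVn.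
Qed.

End Final.

Unset Implicit Arguments.
Set Strict Implicit.

Theorem theorem1p3 (R : realType) (P : countType) (deg : P -> nat)
  (deg_pos : forall p : P, (0 < deg p)%N)
  (deg_fin : forall x : nat, finite_set [set g : {mset P} | (degG deg g <= x)%N])
  (c q eta : R) (c_pos : 0 < c) (q_gt1 : 1 < q) (eta_ge0 : 0 <= eta) (eta_lt1 : eta < 1)
  (axiomA : exists K : R, forall n : nat,
      `|(Gsharp deg n)%:R - c * q ^+ n| <= K * q `^ (eta * n%:R))
  (zeta_nz : Zeta_at_minus_inv_q deg c q != 0)
  (S : set P) (delta : R) (S_density : has_natural_density deg S delta) :
  (forall a : {mset P} -> R[i],
     (forall g, ~ Dset deg S g -> a g = 0) ->
     a mset0 = 1 ->
     (exists l : R,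
        (fun n => \sum_(g \in Dn deg S n)
                   (ComplexField.Normc.normc (a g) / normG deg q g * ln (ln (normG deg q g)))) @ \oo --> l) ->
     (fun n => - \sum_(g \in Dn deg S n) (mu_conv a g / ((normG deg q g)%:C)%C))
       @ \oo --> (delta%:C)%C)
  /\
  ((fun n => - \sum_(g \in Dn deg S n) (mobius R[i] g / ((normG deg q g)%:C)%C))
       @ \oo --> (delta%:C)%C).
Proof.
have [K hK] := axiomA; split; last first.
  exact: (mobius_limit deg_pos deg_fin c_pos q_gt1 eta_lt1 hK zeta_nz S_density).
move=> a a_supp a0 a_sum.
exact: (convolution_limit deg_pos deg_fin c_pos q_gt1 eta_lt1 hK zeta_nz S_density a_supp a0 a_sum).
Qed.
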